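(* Let $K$ be a seed with vertex set $[m]=\{1,\dots,m\}$ and let $J=(j_1,j_2,\dots,j_m)$ be a tuple of positive integers such that $j_v\le 2$ for all $v\in[m]$. Let $\sigma$ be an assembled face of $K(J)$. Then: (1) If $\sigma=\{v\}$ for a vertex $v$ of $K$, then $\mathrm{Ss}_{\{v,v'\}}(K(J))$ is a suspended seed (that is, it is a seed and it is the suspension of a PL sphere), where $v=v^{(0)}$ and $v'=v^{(1)}$ are the two copies of $v$ in $K(J)$. (2) If $|\sigma|>1$ and $K$ is non-suspended, then $\mathrm{Ss}_{\sigma}(K(J))$ is a non-suspended seed.
   Context: All simplicial complexes are finite abstract simplicial complexes, contain the empty set, and are pure (all facets, i.e. inclusion-maximal faces, have the same dimension; the dimension of a face $\sigma$ is $|\sigma|-1$). Every element of the vertex set is assumed to be a vertex of the complex (no ghost vertices). PL spheres: a simplicial complex $K$ is a PL sphere if some subdivision of $K$ is (isomorphic to) a subdivision of the boundary complex of a simplex. The complex $\{\varnothing\}$, the boundary of the $0$-simplex, counts as the $(-1)$-dimensional PL sphere. Links, joins, boundaries: for $\sigma\in K$, $\partial\sigma=\{\tau : \tau\subsetneq\sigma\}$; $\mathrm{St}_K(\sigma)=\{\tau\in K: \tau\cup\sigma\in K\}$; $\mathrm{Lk}_K(\sigma)=\{\tau\in K:\tau\cup\sigma\in K,\ \tau\cap\sigma=\varnothing\}$. For complexes $K,L$ with disjoint vertex sets, $K*L=\{\sigma\cup\tau:\sigma\in K,\tau\in L\}$. A vertex $v$ is also identified with the complex $\{\varnothing,\{v\}\}$.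 Stellar subdivision: for a nonempty $\sigma\in K$, $\mathrm{Ss}_\sigma(K)=(K\setminus \mathrm{St}_K(\sigma))\cup (v_\sigma*\partial\sigma*\mathrm{Lk}_K(\sigma))$, where $v_\sigma$ is a new vertex. Wedge: for a vertex $v$ of $K$ and a new vertex $v'$, let $I$ be the $1$-simplex with vertices $v,v'$ and $\partial I$ its boundary (two points). Then $\mathrm{Wed}_v(K)=(I*\mathrm{Lk}_K(v))\cup(\partial I*\{\sigma\in K: v\notin\sigma\})$. Seed: a PL sphere that is not (isomorphic to) a wedge $\mathrm{Wed}_v(L)$ of any PL sphere $L$ at a vertex $v$ of $L$. Suspension: the suspension of $K$ is $\partial I*K$, where $\partial I$ consists of two new vertices. A PL sphere is suspended if it is the suspension of some PL sphere, and non-suspended otherwise. $J$-construction: for $K$ on $[m]$ and $J=(j_1,\dots,j_m)$ a tuple of positive integers, $K(J)$ is the simplicial complex on $\{v^{(i)}: v\in[m],\ 0\le i\le j_v-1\}$ whose minimal non-faces are exactly the sets $\{v^{(i)}: v\in\omega,\ 0\le i\le j_v-1\}$ for $\omega$ a minimal non-face of $K$; equivalently, it is obtained from $K$ by iterated wedges so that each vertex $v$ has $j_v$ copies. We write $v=v^{(0)}$, $v'=v^{(1)}$. Assembled face: given integers $0\le s_v\le j_v-1$ for each $v\in[m]$, the assembled face of $K(J)$ by $(s_1,\dots,s_m)$ is the set $\{v^{(s_v)}: v\in[m],\ j_v\ge 2\}$ (this set belongs to $K(J)$). An assembled face of $K(J)$ is a set of this form for some choice of $(s_1,\dots,s_m)$.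 *)

(* Defs.v *)
From HB Require Import structures.
From mathcomp Require Import all_boot all_order all_algebra.
From mathcomp Require Import reals.

Set Implicit Arguments.
Unset Strict Implicit.
Unset Printing Implicit Defensive.

Import Order.TTheory GRing.Theory Num.Theory.

(** * Finite abstract simplicial complexes

    A complex is a set of faces [K : {set {set T}}] over a finite type [T].
    Its vertex set is [vertices K], which may be smaller than [T]: elements
    of [T] that lie in no face are not part of the complex. *)

Definition vertices (T : finType) (K : {set {set T}}) : {set T} :=
  [set v | [set v] \in K].

Definition simplicial_complex (T : finType) (K : {set {set T}}) : Prop :=
  set0 \in K /\ (forall s t : {set T}, s \in K -> t \subset s -> t \in K).

Definition facet (T : finType) (K : {set {set T}}) (s : {set T}) : bool :=
  maxset (fun t : {set T} => t \in K) s.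

Definition pure (T : finType) (K : {set {set T}}) : Prop :=
  forall s t : {set T}, facet K s -> facet K t -> #|s| = #|t|.

Definition relabel (T U : finType) (f : T -> U) (K : {set {set T}}) :
    {set {set U}} :=
  [set f @: s | s : {set T} in K].

(* [f] is only meaningful on the vertices of [K]; its values are options so
   that a map exists even when [U] is empty (then [K] has no vertices). *)
Definition isomorphic (T U : finType) (K : {set {set T}}) (L : {set {set U}})
    : Prop :=
  exists f : T -> option U,
    {in vertices K &, injective f} /\ relabel f K = relabel Some L.

Definition boundary (T : finType) (s : {set T}) : {set {set T}} :=
  [set t : {set T} | t \proper s].

Definition star (T : finType) (K : {set {set T}}) (s : {set T}) :
    {set {set T}} :=
  [set t : {set T} in K | t :|: s \in K].

Definition link (T : finType) (K : {set {set T}}) (s : {set T}) :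
    {set {set T}} :=
  [set t : {set T} in K | (t :|: s \in K) && (t :&: s == set0)].

(* Only used for [K] and [L] with disjoint vertex sets. *)
Definition join (T : finType) (K L : {set {set T}}) : {set {set T}} :=
  [set s :|: t | s : {set T} in K, t : {set T} in L].

(** In the next two constructions the new vertex is [None : option T]. *)

Definition stellar_subdivision (T : finType) (s : {set T})
    (K : {set {set T}}) : {set {set option T}} :=
  relabel Some (K :\: star K s)
  :|: join (powerset [set None])
        (join (relabel Some (boundary s)) (relabel Some (link K s))).

Definition wedge (T : finType) (v : T) (K : {set {set T}}) :
    {set {set option T}} :=
  let I : {set option T} := [set Some v; None] in
  join (powerset I) (relabel Some (link K [set v]))
  :|: join (boundary I) (relabel Some [set s : {set T} in K | v \notin s]).

(* The two new vertices are [inl true] and [inl false]. *)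
Definition suspension (T : finType) (K : {set {set T}}) :
    {set {set (bool + T)%type}} :=
  join (boundary [set inl true; inl false]) (relabel inr K).

(** * PL spheres *)

Section Realization.
Local Open Scope ring_scope.
Variable R : realType.

Definition support (T : finType) (x : {ffun T -> R}) : {set T} :=
  [set v | x v != 0].

Definition realization (T : finType) (K : {set {set T}}) (x : {ffun T -> R})
    : Prop :=
  [/\ forall v, 0 <= x v, \sum_v x v = 1 & support x \in K].

Definition linear_extension (U T : finType) (p : U -> {ffun T -> R})
    (y : {ffun U -> R}) : {ffun T -> R} :=
  [ffun v => \sum_u y u * p u v].

(* [K'] is a subdivision of [K]: a placement [p] of the vertices of [K'] in
   the realization of [K] whose linear extension carries each simplex of [K']
   into a simplex of [K] and is a bijection, hence (the realizations being
   compact) a homeomorphism, of the realizations.  If [K] is pure, so is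
   [K']. *)
Definition subdivision (U T : finType) (K' : {set {set U}})
    (K : {set {set T}}) : Prop :=
  simplicial_complex K' /\
  exists p : U -> {ffun T -> R},
  [/\ forall s, s \in K' ->
        exists2 t, t \in K & forall u, u \in s -> support (p u) \subset t,
      forall y, realization K' y -> realization K (linear_extension p y),
      forall y z, realization K' y -> realization K' z ->
        linear_extension p y = linear_extension p z -> y = z
    & forall x, realization K x ->
        exists2 y, realization K' y & linear_extension p y = x].

(* For [n = 0] the boundary of the simplex is [[set set0]], the sphere of
   dimension -1. *)
Definition pl_sphere (T : finType) (K : {set {set T}}) : Prop :=
  [/\ simplicial_complex K, pure K &
      exists (n : nat) (U W : finType) (K' : {set {set U}})
             (B' : {set {set W}}),
      [/\ subdivision K' K, subdivision B' (boundary [set: 'I_n.+1])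
        & isomorphic K' B']].

Definition seed (T : finType) (K : {set {set T}}) : Prop :=
  pl_sphere K /\
  ~ exists (U : finType) (L : {set {set U}}) (v : U),
      [/\ pl_sphere L, v \in vertices L & isomorphic K (wedge v L)].

Definition suspended (T : finType) (K : {set {set T}}) : Prop :=
  exists (U : finType) (L : {set {set U}}),
    pl_sphere L /\ isomorphic K (suspension L).

End Realization.

(** * The J-construction *)

(* The pair [(v, i)] with [i < J v] is the copy v^(i). *)
Definition copies (T : finType) (J : T -> nat) : finType :=
  {v : T & 'I_(J v)}.

Definition copy (T : finType) (J : T -> nat) (v : T) (i : 'I_(J v)) :
    copies J :=
  Tagged (fun w : T => 'I_(J w)) i.

Definition minimal_nonface (T : finType) (K : {set {set T}}) (w : {set T})
    : bool :=
  minset (fun t : {set T} => t \notin K) w.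

Definition all_copies (T : finType) (J : T -> nat) (w : {set T}) :
    {set copies J} :=
  [set x | tag x \in w].

Definition J_construction (T : finType) (K : {set {set T}}) (J : T -> nat) :
    {set {set copies J}} :=
  [set s : {set copies J} |
    [forall w : {set T}, minimal_nonface K w ==> ~~ (all_copies J w \subset s)]].

Definition assembled_face (T : finType) (J : T -> nat)
    (s : forall v, 'I_(J v)) : {set copies J} :=
  [set copy (s v) | v : T & 1 < J v].

(* Main.v *)
(** Two vertices are twins when every minimal non-face contains both or
    neither of them.  A complex with twins [a], [b] is the wedge of the link of
    [b] at [a] if [{a, b}] is a face, and the suspension of that link
    otherwise; conversely wedges and suspensions have twins.  Since links of
    vertices of PL spheres are PL spheres, being a seed (and non-suspended)
    becomes the absence of twins, and twins of the subdivided complex are seen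
    to induce twins of [K].

    The PL topology rests on one construction.  If [K'] subdivides [K] and a
    stellar subdivision of [K] is given, cut [K'] along the hyperplanes
    [x_i w_j = x_j w_i], where [w] is the center and [i], [j] run over the
    subdivided face; each cut is made of stellar subdivisions of edges.  The
    result refines both.  Hence stellar subdivisions of PL spheres are PL
    spheres, and, after subdividing the boundary of the simplex so that a given
    point becomes a vertex, so are links of vertices.  Wedges are PL spheres
    since subdividing their new edge gives a suspension. *)

From mathcomp Require Import all_boot all_order all_algebra.
From mathcomp Require Import reals boolp.
From mathcomp Require Import ring lra zify.
Require Import Defs.

Set Implicit Arguments.
Unset Strict Implicit.
Unset Printing Implicit Defensive.

Import Order.TTheory GRing.Theory Num.Theory.

(** * Complexes, isomorphisms and stellar subdivisions *)

(** The definition of a PL sphere provides only some common subdivision of [K] and a simplex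
    boundary, with no control over its shape, so it need not refine a stellar subdivision of [K].
    The cuts repair this because the stellar subdivision at [w] sorts a point [x] by the index [i]
    that minimizes [x_i / w_i] over the support of [w], and comparing two such ratios is a linear
    condition. A simplex that no cut crosses therefore lies over a single simplex of the stellar
    subdivision. Points are taken up to positive scaling, so that centers and coordinates carry no
    normalization. A sphere is handled as a complex that shares a refinement with a simplex
    boundary: coarsening is then mere composition, and cuts serve only for stellar subdivisions. For
    links, one and the same vertex of the refinement must lie over a vertex on both sides, which is
    why the simplex boundary is subdivided. On the combinatorial side, the assembled face is a
    minimal non-face of the subdivided complex, which separates its elements from all other
    vertices. *)

Local Ltac set_tauto :=
  by apply/setP=> ?; rewrite ?inE; do ?case: (_ \in _); do ?case: (_ == _).

Lemma face_vertex (T : finType) (K : {set {set T}}) (s : {set T}) (v : T) :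
  simplicial_complex K -> s \in K -> v \in s -> v \in vertices K.
Proof. by move=> [_ Kd] sK vs; rewrite inE; apply: Kd sK _; rewrite sub1set. Qed.

Definition iso_map (T U : finType) (f : T -> option U) (K : {set {set T}})
    (L : {set {set U}}) : Prop :=
  [/\ {in vertices K &, injective f},
      forall s, s \in K -> exists2 t, t \in L & f @: s = Some @: t
    & forall t, t \in L -> exists2 s, s \in K & f @: s = Some @: t].

Lemma isomorphicP (T U : finType) (K : {set {set T}}) (L : {set {set U}}) :
  isomorphic K L <-> exists f, @iso_map T U f K L.
Proof.
split=> -[f].
  move=> [fi fKL]; exists f; split=> // [s sK|t tL].
    have : f @: s \in relabel f K by apply: imset_f.
    by rewrite fKL => /imsetP[t tL ->]; exists t.
  have : Some @: t \in relabel Some L by apply: imset_f.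
  by rewrite -fKL => /imsetP[s sK ->]; exists s.
move=> [fi fK fL]; exists f; split=> //; apply/setP=> r; apply/imsetP/imsetP.
  by move=> [s /fK[t tL ->] ->]; exists t.
by move=> [t /fL[s sK <-] ->]; exists s.
Qed.

Lemma mem_some_imset (U : finType) (t : {set U}) (o : option U) :
  (o \in Some @: t) = if o is Some u then u \in t else false.
Proof.
case: o => [u|]; first by rewrite mem_imset // => ? ? [].
by apply/imsetP=> -[].
Qed.

Lemma isomorphic_relabel (T U : finType) (f : T -> U) (K : {set {set T}}) :
  {in vertices K &, injective f} -> isomorphic K (relabel f K).
Proof.
move=> fi; exists (Some \o f); split.
  by move=> x y xK yK [/fi]; apply.
by rewrite /relabel -imset_comp; apply: eq_imset => s /=; rewrite imset_comp.
Qed.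

Lemma isomorphic_sym (T U : finType) (K : {set {set T}}) (L : {set {set U}}) :
  simplicial_complex K -> isomorphic K L -> isomorphic L K.
Proof.
move=> Kc /isomorphicP[f [fi fK fL]]; apply/isomorphicP.
pose g u := [pick x in vertices K | f x == Some u].
have gP x u : x \in vertices K -> f x = Some u -> g u = Some x.
  move=> xK fx; rewrite /g; case: pickP => [y /andP[yK /eqP fy]|/(_ x)].
    by congr Some; apply: fi => //; rewrite fy.
  by rewrite xK fx eqxx.
have gs s (t : {set U}) : s \in K -> f @: s = Some @: t -> g @: t = Some @: s.
  move=> sK st; apply/setP=> o; apply/imsetP/imsetP=> -[x xs ->].
    have : Some x \in f @: s by rewrite st mem_some_imset.
    by move=> /imsetP[y ys e]; exists y; rewrite ?(gP y) ?(face_vertex Kc sK).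
  have : f x \in Some @: t by rewrite -st imset_f.
  rewrite mem_some_imset; case e: (f x) => [u|] // ut; exists u => //.
  by rewrite (gP x) ?(face_vertex Kc sK).
exists g; split.
- have gV u : u \in vertices L -> exists2 x, f x = Some u & g u = Some x.
    rewrite inE => /fL[s sK st].
    have : Some u \in f @: s by rewrite st mem_some_imset inE.
    by case/imsetP=> x xs e; exists x; rewrite ?(gP x) ?(face_vertex Kc sK).
  move=> u u' /gV[x xu ->] /gV[x' xu' ->] [] e.
  by move: xu; rewrite e xu' => -[].
- by move=> t /fL[s sK st]; exists s => //; apply: gs.
- by move=> s sK; have [t tL st] := fK s sK; exists t => //; apply: gs.
Qed.

Lemma isomorphic_trans (T U V : finType) (K : {set {set T}}) (L : {set {set U}})
    (M : {set {set V}}) :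
  simplicial_complex L -> isomorphic K L -> isomorphic L M -> isomorphic K M.
Proof.
move=> Lc /isomorphicP[f [fi fK fL]] /isomorphicP[g [gi gL gM]].
apply/isomorphicP; exists (fun x => obind g (f x)).
have c (s : {set T}) (t : {set U}) : f @: s = Some @: t ->
    [set obind g (f x) | x in s] = g @: t.
  move=> st; rewrite -[LHS]/((obind g \o f) @: s) imset_comp st -imset_comp.
  exact: eq_imset.
split.
- have fV x : x \in vertices K -> exists2 u, u \in vertices L & f x = Some u.
    rewrite inE => /fK[t tL]; rewrite imset_set1 => e.
    have : f x \in Some @: t by rewrite -e set11.
    rewrite mem_some_imset; case: (f x) => // u ut.
    by exists u => //; apply: face_vertex tL ut.
  move=> x y xK yK; have [u uL fx] := fV x xK; have [v vL fy] := fV y yK.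
  by rewrite fx fy /= => /(gi _ _ uL vL) uv; apply: fi; rewrite // fx fy uv.
- move=> s /fK[t tL st]; have [r rM tr] := gL t tL; exists r => //.
  by rewrite (c _ t).
- move=> r /gM[t tL tr]; have [s sK st] := fL t tL; exists s => //.
  by rewrite (c _ t).
Qed.

Definition somes (T : finType) (S : {set option T}) : {set T} :=
  [set x | Some x \in S].

Lemma somesU (T : finType) (S S' : {set option T}) :
  somes (S :|: S') = somes S :|: somes S'.
Proof. by apply/setP=> x; rewrite !inE. Qed.

Lemma somesS (T : finType) (S S' : {set option T}) :
  S \subset S' -> somes S \subset somes S'.
Proof. by move=> /subsetP SS'; apply/subsetP=> x; rewrite !inE => /SS'. Qed.

Lemma somesK (T : finType) (F : {set T}) : somes (Some @: F) = F.
Proof. by apply/setP=> x; rewrite inE mem_some_imset. Qed.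

Lemma somes_set1 (T : finType) (x : T) : somes [set Some x] = [set x].
Proof. by apply/setP=> y; rewrite !inE. Qed.

Lemma somes_set1N (T : finType) : somes [set None] = set0 :> {set T}.
Proof. by apply/setP=> y; rewrite !inE. Qed.

(* Unlike [stellar_subdivision], this is also meaningful when [s] is not a
   face of [K]; it is then a copy of [K]. *)
Definition stell (T : finType) (s : {set T}) (K : {set {set T}}) :
    {set {set option T}} :=
  [set S | ~~ (s \subset somes S) &&
           (somes S :|: (if None \in S then s else set0) \in K)].

Lemma stell_complex (T : finType) (s : {set T}) (K : {set {set T}}) :
  simplicial_complex K -> s != set0 -> simplicial_complex (stell s K).
Proof.
move=> [K0 Kd] s0; split.
  have e : somes set0 = set0 :> {set T} by apply/setP=> x; rewrite !inE.
  by rewrite inE e inE setU0 K0 subset0 s0.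
move=> S S' /[!inE] /andP[sS SK] S'S; have so := somesS S'S; apply/andP; split.
  by apply: contra sS => /subset_trans; apply.
apply: Kd SK _; apply: setUSS so _; have [NS'|_] := boolP (None \in S').
  by rewrite (subsetP S'S _ NS').
exact: sub0set.
Qed.

Lemma stellE (T : finType) (s : {set T}) (K : {set {set T}}) :
  simplicial_complex K -> s \in K -> stellar_subdivision s K = stell s K.
Proof.
move=> [_ Kd] sK; apply/setP=> S; apply/idP/idP.
  rewrite inE => /orP[/imsetP[F]|/imset2P[A B]].
    rewrite !inE negb_and => /andP[FsK FK] ->;
      rewrite somesK mem_some_imset setU0 FK andbT.
    by move: FsK; rewrite FK /=; apply: contra => /setUidPl ->.
  rewrite inE => AN /imset2P[C D /imsetP[t ts ->] /imsetP[G Gl ->] ->] ->.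
  move: ts Gl; rewrite !inE => ts /and3P[GK GsK /eqP Gs].
  rewrite !somesU !somesK; have -> : somes A = set0.
    by apply/setP=> x; rewrite !inE; apply/negP=> /(subsetP AN); rewrite inE.
  rewrite set0U; apply/andP; split.
    move: ts; rewrite properE => /andP[_]; apply: contra => /subsetP st.
    apply/subsetP=> x xs; have := st _ xs; rewrite inE => /orP[//|xG].
    by have := in_set0 x; rewrite -Gs inE xG xs.
  apply: Kd GsK _; rewrite !subUset subsetUl (subset_trans (proper_sub ts)
    (subsetUr _ _)) /=.
  by case: ifP => _; rewrite ?sub0set ?subsetUr.
rewrite inE => /andP[sS SK]; rewrite inE.
(* The split is on membership in the star and not on [None \in S]: the cone over the boundary also
   contains faces without the center. Outside the star [None] cannot occur. *)
have [SsK|SsK] := boolP (somes S :|: s \in K).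
  apply/orP; right; apply/imset2P.
  exists (S :&: [set None]) (Some @: (somes S)).
  - by rewrite inE subsetIr.
  - apply/imset2P; exists (Some @: (somes S :&: s)) (Some @: (somes S :\: s)).
    + apply: imset_f; rewrite inE properE subsetIr; apply: contra sS => h.
      exact: subset_trans h (subsetIl _ _).
    + apply: imset_f; rewrite !inE (Kd _ _ SsK) /=; last by apply/subsetP=> x;
      rewrite !inE => /andP[_ ->].
      apply/andP; split; first by congr (_ \in K): SsK; set_tauto.
      by apply/eqP; set_tauto.
    + by rewrite -imsetU setID.
  - apply/setP=> -[x|]; rewrite !inE mem_some_imset ?inE ?andbF //.
    by rewrite eqxx orbF andbT.
apply/orP; left; apply/imsetP; exists (somes S).
  rewrite !inE negb_and SsK orbT /=; move: SK; case: ifP => [_ h|_];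
    first by rewrite h in SsK.
  by rewrite setU0.
apply/setP=> -[x|]; rewrite mem_some_imset ?inE //.
by move: SK; case: ifP => // _; rewrite (negPf SsK).
Qed.

Definition rights (T : finType) (S : {set (bool + T)%type}) : {set T} :=
  [set x | inr x \in S].

Lemma suspensionE (T : finType) (K : {set {set T}}) (S : {set (bool + T)%type}) :
  (S \in suspension K) =
  ~~ ((inl true \in S) && (inl false \in S)) && (rights S \in K).
Proof.
apply/imset2P/idP.
  move=> [A B /[!inE] AI /imsetP[F FK ->] ->].
  have lA (o : bool + T) : o \in A -> exists e, o = inl e.
    by move=> /(subsetP (proper_sub AI)); rewrite !inE => /orP[]/eqP->; eexists.
  have -> : rights (A :|: inr @: F) = F.
    apply/setP=> x; rewrite !inE mem_imset; last by move=> ? ? [].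
    by apply/orP/idP=> [[/lA[]|]|]; [|done|right].
  have lF e : (inl e \in [set inr x | x in F]) = false by apply/imsetP=> -[].
  rewrite !inE !lF !orbF FK andbT; move: AI; rewrite properE => /andP[_].
  by apply: contra => /andP[tA fA]; rewrite subUset !sub1set tA fA.
move=> /andP[tf SK]; exists (S :&: [set inl true; inl false]) (inr @: rights S).
- rewrite inE properE subsetIr; apply: contra tf => /subsetP h.
  by apply/andP; split; (have := h (inl _)); [move=> /(_ true)|move=> /(_ false)];
    rewrite !inE eqxx ?orbT => /(_ isT) /andP[].
- exact: imset_f.
- apply/setP=> -[e|x]; rewrite !inE.
    have -> : (inl e \in [set inr x | x in rights S]) = false
      by apply/imsetP=> -[].
    by case: e; rewrite eqxx ?orbT ?andbT orbF.
  by rewrite andbF mem_imset ?inE // => ? ? [].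
Qed.

Lemma suspension_complex (T : finType) (K : {set {set T}}) :
  simplicial_complex K -> simplicial_complex (suspension K).
Proof.
move=> [K0 Kd]; split.
  rewrite suspensionE !inE /=; have -> // : rights set0 = set0 :> {set T}.
  by apply/setP=> x; rewrite !inE.
move=> S S'; rewrite !suspensionE => /andP[tf SK] /subsetP S'S; apply/andP; split.
  by apply: contra tf => /andP[/S'S-> /S'S->].
by apply: Kd SK _; apply/subsetP=> x; rewrite !inE => /S'S.
Qed.

Lemma boundary_complex (T : finType) (s : {set T}) :
  s != set0 -> simplicial_complex (boundary s).
Proof.
move=> s0; split=> [|t r]; first by rewrite inE properEneq eq_sym s0 sub0set.
by rewrite !inE => ts rt; apply: sub_proper_trans rt ts.
Qed.

Lemma boundary_isomorphic (T : finType) (s : {set T}) : s != set0 ->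
  isomorphic (boundary s) (boundary [set: 'I_#|s|.-1.+1]).
Proof.
move=> /set0Pn[w ws]; have s0 : 0 < #|s| by apply/card_gt0P; exists w.
pose f x : 'I_#|s|.-1.+1 := inord (enum_rank_in ws x).
have fi : {in s &, injective f}.
  move=> x y xs ys /(congr1 val); rewrite /= !inordK ?prednK ?ltn_ord //.
  by move=> /val_inj/(can_in_inj (enum_rankK_in ws)); apply.
have fs : f @: s = setT.
  by apply/eqP; rewrite eqEcard subsetT cardsT card_ord card_in_imset ?prednK /=.
have -> : boundary setT = relabel f (boundary s).
  apply/setP=> r; apply/idP/imsetP; rewrite inE properE subsetT /=.
    move=> rT; exists (s :&: f @^-1: r).
      rewrite inE properE subsetIl; apply: contra rT => /subsetP h.
      rewrite -fs; apply/subsetP=> _ /imsetP[x xs ->].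
      by have := h x xs; rewrite !inE => /andP[].
    apply/setP=> i; apply/idP/imsetP=> [ir|[x]];
      last by rewrite !inE => /andP[_ ?] ->.
    have : i \in f @: s by rewrite fs inE.
    by case/imsetP=> x xs e; exists x; rewrite // !inE xs -e.
  move=> [t /[!inE] ts ->]; apply/negP=> h.
  have : #|f @: t| < #|s|.
    by apply: leq_ltn_trans (leq_imset_card _ _) (proper_card ts).
  have /eqP-> : f @: t == setT by rewrite eqEsubset subsetT.
  by rewrite cardsT card_ord prednK // ltnn.
apply: isomorphic_relabel => x y; rewrite !inE => xs ys; apply: fi.
  by move/proper_sub: xs; rewrite sub1set.
by move/proper_sub: ys; rewrite sub1set.
Qed.

Lemma link1E (T : finType) (K : {set {set T}}) (v : T) (s : {set T}) :
  simplicial_complex K ->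
  (s \in link K [set v]) = (v \notin s) && (v |: s \in K).
Proof.
move=> [_ Kd]; rewrite !inE setUC;
  have -> : (s :&: [set v] == set0) = (v \notin s).
  by rewrite setI_eq0 disjoints_subset subsetC sub1set inE.
have [sK|] := boolP (v |: s \in K); last by rewrite !andbF.
by rewrite (Kd _ _ sK) ?subsetUr ?andbT.
Qed.

Lemma link1_complex (T : finType) (K : {set {set T}}) (v : T) :
  simplicial_complex K -> [set v] \in K -> simplicial_complex (link K [set v]).
Proof.
move=> Kc vK; split; first by rewrite link1E // inE setU0.
move=> s t; rewrite !link1E // => /andP[vs sK] ts; apply/andP; split.
  by apply: contra vs => /(subsetP ts).
by case: Kc => _; apply; [apply: sK|apply: setUS].
Qed.

(** * Twin vertices *)

Lemma mem_imset_pcan (T U : finType) (f : T -> U) (g : U ->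
  option T) (s : {set T}) u :
  pcancel f g -> ocancel g f ->
  (u \in f @: s) = (if g u is Some x then x \in s else false).
Proof.
move=> fg gf; apply/imsetP/idP=> [[x xs ->]|]; first by rewrite fg.
by have := gf u; case: (g u) => //= x <- xs; exists x.
Qed.

(** The tool for most explicit isomorphisms below: [f] may miss elements of [U], and the third
    hypothesis keeps those out of the faces of [L]. *)
Lemma isomorphic_pcan (T U : finType) (f : T -> U) (g : U -> option T)
    (K : {set {set T}}) (L : {set {set U}}) :
  pcancel f g -> ocancel g f ->
  (forall (t : {set U}) u, t \in L -> u \in t -> g u) ->
  (forall s : {set T}, (f @: s \in L) = (s \in K)) -> isomorphic K L.
Proof.
move=> fg gf Lg KL; have -> : L = relabel f K.
  apply/setP=> t; apply/idP/imsetP=> [tL|[s sK ->]]; last by rewrite KL.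
  have e : t = f @: [set x | f x \in t].
    apply/setP=> u; apply/idP/imsetP=> [ut|[x]]; last by rewrite inE => ? ->.
    have := gf u; have := Lg _ _ tL ut; case: (g u) => //= x _ fx.
    by exists x; rewrite ?inE fx.
  by exists [set x | f x \in t]; rewrite // -KL -e.
by apply: isomorphic_relabel => x y _ _; apply: (pcan_inj fg).
Qed.

(** The condition on minimal non-faces, read on faces: if [a |: F] is not a face, it contains a
    minimal non-face, which contains [a] and misses [b]; conversely, removing [a] from a minimal
    non-face with [a] but without [b] gives a face that violates the condition. *)
Definition twins (T : finType) (a b : T) (K : {set {set T}}) : Prop :=
  forall F, F \in K ->
    (b \notin F -> a |: F \in K) /\ (a \notin F -> b |: F \in K).

Lemma twins_sym (T : finType) (a b : T) K : twins a b K -> twins b a K.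
Proof. by move=> ab F /ab[]. Qed.

(** With at most one twin in [F], it does not matter which one, if any. Putting in [b] turns
    membership in [K] into membership in the link of [b], from which [K] is rebuilt. *)
Lemma twins_mem (T : finType) (a b : T) K (F : {set T}) :
  simplicial_complex K -> a != b -> twins a b K -> ~~ ((a \in F) && (b \in F)) ->
  (b |: (F :\ a :\ b) \in K) = (F \in K).
Proof.
move=> [_ Kd] nab ab nF; pose H := F :\ a :\ b.
have aH : a \notin H by rewrite !inE eqxx andbF.
have bH : b \notin H by rewrite !inE eqxx.
apply/idP/idP=> [bHK|FK]; last first.
  by have [_ /(_ aH)] := ab H (Kd _ _ FK (subset_trans (subD1set _ _) (subD1set _
    _))).
have HK : H \in K by apply: Kd bHK (subsetUr _ _).
have [aF|aF] := boolP (a \in F).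
  have bF : b \notin F by move: nF; rewrite aF.
  have -> : F = a |: H; last by have [/(_ bH)] := ab H HK.
  apply/setP=> x; rewrite !inE; have [->|_] /= := eqVneq x a; first by rewrite aF.
  by have [->|//] := eqVneq x b; rewrite (negPf bF).
apply: Kd bHK _; apply/subsetP=> x xF; rewrite !inE xF andbT.
have [//|xb] := eqVneq x b; rewrite ?eqxx ?orbT //=.
by apply: contraNneq aF => <-.
Qed.

(** Once their edge is subdivided, [a] and [b] are not adjacent and become the poles, while the
    center [None] takes the place of [a] in the link of [b]. If the pair is not a face, neither
    [None] nor [a] is a vertex there, and the same map works. *)
Lemma twins_stell_isomorphic (T : finType) (a b : T) K :
  simplicial_complex K -> a != b -> twins a b K ->
  isomorphic (stell [set a; b] K) (suspension (link K [set b])).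
Proof.
move=> Kc nab ab; have nba : b != a by rewrite eq_sym.
pose f (o : option T) : bool + T :=
  if o is Some x then if x == a then inl true else if x == b then inl false else
    inr x
  else inr a.
pose g (o : bool + T) : option (option T) :=
  match o with
  | inl e => Some (Some (if e then a else b))
  | inr x => if x == a then Some None else if x == b then None else Some (Some x)
  end.
have fg : pcancel f g.
  case=> [x|] /=; last by rewrite eqxx.
  case: eqVneq => [->//|xa]; case: eqVneq => [->//|xb] /=.
  by rewrite (negPf xa) (negPf xb).
have gf : ocancel g f.
  case=> [[]|x] /=; rewrite ?eqxx ?(negPf nba) //.
  case: eqVneq => [->//|xa]; case: eqVneq => //= xb.
  by rewrite (negPf xa) (negPf xb).
apply: (isomorphic_pcan fg gf).
  move=> t [e|x] //=; rewrite suspensionE link1E // => /andP[_ /andP[bt _]] xt.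
  case: eqP => // _; case: eqP => // xb.
  by move: bt; rewrite inE -xb xt.
move=> S; rewrite suspensionE link1E // [RHS]inE subUset !sub1set.
rewrite !inE !(mem_imset_pcan _ _ fg gf) /= eqxx (negPf nba) /=.
case tf: ((Some a \in S) && (Some b \in S)) => //=.
have [NS|NS] := boolP (None \in S).
  congr (_ \in K); apply/setP=> x; rewrite !inE (mem_imset_pcan _ _ fg gf) /=.
  have [->|xa] := eqVneq x a; first by rewrite NS !orbT.
  by have [->|xb] := eqVneq x b; rewrite ?orbT ?orbF.
rewrite setU0 -(twins_mem (F := somes S) Kc nab ab); last by rewrite !inE tf.
congr (_ \in K); apply/setP=> x; rewrite !inE (mem_imset_pcan _ _ fg gf) /=.
by have [->|xa] := eqVneq x a; [rewrite (negPf NS) andbF | have [] := eqVneq x b].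
Qed.

Lemma twins_suspension_isomorphic (T : finType) (a b : T) K :
  simplicial_complex K -> a != b -> twins a b K -> [set a; b] \notin K ->
  isomorphic K (suspension (link K [set b])).
Proof.
move=> Kc nab ab abK; have nba : b != a by rewrite eq_sym.
pose f x : bool + T := if x == a then inl true else if x == b then inl false else
  inr x.
pose g (o : bool + T) : option T :=
  match o with
  | inl e => Some (if e then a else b)
  | inr x => if (x == a) || (x == b) then None else Some x
  end.
have fg : pcancel f g.
  rewrite /f => x; case: eqVneq => [->//|xa]; case: eqVneq => [->//|xb] /=.
  by rewrite (negPf xa) (negPf xb).
have gf : ocancel g f.
  rewrite /f; case=> [[]|x] /=; rewrite ?eqxx ?(negPf nba) //.
  case: eqVneq => [->//|xa]; case: eqVneq => //= xb.
  by rewrite (negPf xa) (negPf xb).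
apply: (isomorphic_pcan fg gf).
  move=> t [e|x] //=; rewrite suspensionE link1E // => /andP[_ /andP[bt tK]] xt.
  case: eqP => [xa|_] /=.
    case/negP: abK; case: Kc => _; apply; first exact: tK.
    by rewrite subUset !sub1set !inE eqxx -xa xt orbT.
  by case: eqP => // xb; move: bt; rewrite inE -xb xt.
move=> s; rewrite suspensionE link1E // !inE !(mem_imset_pcan _ _ fg gf) /= eqxx
  orbT /=.
case tf: ((a \in s) && (b \in s)) => /=.
  apply/esym/negbTE; apply: contra abK => sK; case: Kc => _; apply;
    first exact: sK.
  by rewrite subUset !sub1set.
rewrite -(twins_mem (F := s) Kc nab ab) ?tf //.
congr (_ \in K); apply/setP=> x; rewrite !inE (mem_imset_pcan _ _ fg gf) /=.
by have [->|xa] := eqVneq x a; [rewrite andbF | have [] := eqVneq x b].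
Qed.

(** In a wedge an element [v] of a minimal non-face stands for both copies. Without [None], an
    occurrence of [Some v] therefore imposes no condition and is removed. *)
Lemma wedgeE (T : finType) (v : T) (K : {set {set T}}) (S : {set option T}) :
  simplicial_complex K ->
  (S \in wedge v K) =
  if None \in S then somes S \in K else somes S :\ v \in K.
Proof.
move=> Kc; have Kd := Kc.2.
have sI (A : {set option T}) : A \subset [set Some v;
  None] -> somes A \subset [set v].
  by move=> /somesS; rewrite somesU somes_set1 somes_set1N setU0.
have IE (A : {set option T}) : None \notin A -> Some v \notin A ->
    A = Some @: somes A.
  move=> NA vA; apply/setP=> -[x|]; rewrite mem_some_imset ?inE //.
  exact/negbTE.
rewrite inE; apply/orP/idP.
  case=> /imset2P[A B /[!inE] AI /imsetP[F + ->] ->].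
    rewrite -[X in (X -> _)]/(is_true (F \in link K [set v])) link1E // =>
      /andP[vF FK].
    rewrite somesU somesK !inE mem_some_imset orbF; case: ifP => _.
      by apply: Kd FK _; apply: setSU; apply: sI.
    apply: Kd FK _; apply: subset_trans (subD1set _ _) _.
    by apply: setSU; apply: sI.
  rewrite inE => /andP[FK vF]; rewrite somesU somesK !inE mem_some_imset orbF.
  have As := sI _ (proper_sub AI); case: ifP => NA.
    have -> : somes A = set0; last by rewrite set0U.
    apply/eqP; rewrite -subset0; apply/subsetP=> x xA.
    have := subsetP As x xA; rewrite inE => /eqP xv; move: AI xA.
    rewrite properE => /andP[_ /negP nI]; rewrite inE xv => vA.
    by case: nI; rewrite subUset !sub1set vA NA.
  apply: Kd FK _; rewrite setDUl subUset subsetDl andbT.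
  by apply/subsetP=> x; rewrite in_setD1 => /andP[xv /(subsetP As)];
    rewrite inE (negPf xv).
pose A := S :&: [set Some v; None]; pose F := somes S :\ v.
have SE : S = A :|: Some @: F.
  apply/setP=> -[x|]; rewrite !inE mem_some_imset ?inE.
    by rewrite -[Some x == Some v]/(x == v); case: (x == v); case: (Some x \in S).
  by rewrite eqxx orbT andbT orbF.
(* The join with the edge accounts for the sets with both copies; any other set meets [I] in a
   proper subset and falls under the second join. *)
have [/andP[NS vS]|NvS] := boolP ((None \in S) && (Some v \in S)).
  rewrite NS => SK; left; apply/imset2P; exists A (Some @: F) => //.
    by rewrite inE subsetIr.
  by apply: imset_f; rewrite link1E // !inE eqxx /= setD1K ?inE.
move=> SK; right; apply/imset2P; exists A (Some @: F) => //.
  rewrite inE properE subsetIr; apply: contra NvS => /subsetP h.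
  have := h None; rewrite !inE /= andbT => ->; rewrite ?orbT //.
  by have := h (Some v); rewrite !inE eqxx /= andbT => ->.
apply: imset_f; rewrite !inE eqxx andbT /=; move: SK; case: ifP => _ // SK.
exact: Kd SK (subD1set _ _).
Qed.

Lemma twins_wedge_isomorphic (T : finType) (a b : T) K :
  simplicial_complex K -> a != b -> twins a b K -> [set a; b] \in K ->
  isomorphic K (wedge a (link K [set b])).
Proof.
move=> Kc nab ab abK; have bK : [set b] \in K by apply: Kc.2 abK (subsetUr _ _).
have Lc := link1_complex Kc bK.
pose f x : option T := if x == b then None else Some x.
pose g (o : option T) : option T :=
  if o is Some x then if x == b then None else Some x else Some b.
have fg : pcancel f g.
  by rewrite /f => x; case: eqVneq => [->//|xb] /=; rewrite (negPf xb).
have gf : ocancel g f.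
  rewrite /f; case=> [x|] /=; rewrite ?eqxx //.
  by case: eqVneq => //= xb; rewrite (negPf xb).
apply: (isomorphic_pcan fg gf).
  move=> t [x|] //=; rewrite wedgeE //; case: ifP => Nt;
    rewrite link1E // => /andP[bt _] xt;
    case: eqP => // xb; move: bt; rewrite !inE -xb xt //.
  by rewrite xb eq_sym nab.
move=> s; rewrite wedgeE // !link1E // !(mem_imset_pcan _ _ fg gf) /=.
have e : somes (f @: s) = s :\ b.
  by apply/setP=> x; rewrite !inE (mem_imset_pcan _ _ fg gf) /=; case: eqP.
rewrite e; case: ifP => bs; first by rewrite setD11 setD1K.
rewrite -(twins_mem (F := s) Kc nab ab) ?bs ?andbF // !inE eqxx andbF /=.
by congr (_ |: _ \in K); apply/setP=> x; rewrite !inE andbCA.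
Qed.

Lemma wedge_twins (T : finType) (v : T) (K : {set {set T}}) :
  simplicial_complex K -> twins (Some v) None (wedge v K).
Proof.
move=> Kc F; rewrite !wedgeE // => FK; split=> [NF|vF].
  rewrite !inE (negPf NF) /=; move: FK; rewrite (negPf NF) somesU somes_set1.
  by rewrite setDUl setDv set0U.
rewrite !inE eqxx /= somesU somes_set1N set0U; move: FK; case: ifP => // _.
by rewrite (setDidPl _) // disjoint_sym disjoints1 inE.
Qed.

Lemma suspension_twins_poles (T : finType) (K : {set {set T}}) :
  twins (inl true) (inl false) (suspension K).
Proof.
have rE e F : rights (inl e |: F) = rights F :> {set T}.
  by apply/setP=> x; rewrite !inE.
move=> F; rewrite !suspensionE !rE !inE /= => /andP[_ FK].
by split=> /negPf ->; rewrite FK ?andbF.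
Qed.

(** Twins of [L] are vertices, as the empty face shows, so they have preimages. Since [f] is
    injective on vertices only, the argument is confined to subsets of [vertices K]. *)
Lemma isomorphic_twins (T U : finType) (K : {set {set T}}) (L : {set {set U}}) (a
  b : U) :
  simplicial_complex K -> isomorphic K L ->
  set0 \in L -> a != b -> twins a b L ->
  exists x y, [/\ x != y, twins x y K & [set a; b] \in L -> [set x; y] \in K].
Proof.
move=> Kc /isomorphicP[f [fi fK fL]] L0 nab ab.
have preim c : [set c] \in L -> exists2 x, x \in vertices K & f x = Some c.
  move=> /fL[s sK e]; have : Some c \in f @: s by rewrite e mem_some_imset inE.
  by case/imsetP=> x xs cx; exists x => //; apply: face_vertex sK xs.
have [aL bL] : [set a] \in L /\ [set b] \in L.
  by have := ab _ L0; rewrite !inE => -[/(_ isT) + /(_ isT)]; rewrite !setU0.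
have [x xK fx] := preim a aL; have [y yK fy] := preim b bL.
have reflect_ (A : {set T}) (G : {set U}) : A \subset vertices K -> G \in L ->
    f @: A = Some @: G -> A \in K.
  move=> AK GL AG; have [s sK sG] := fL G GL; congr (_ \in K): (sK).
  have sV : s \subset vertices K by apply/subsetP=> z; apply: face_vertex sK.
  apply/setP=> z; apply/idP/idP=> zs.
    have : f z \in f @: A by rewrite AG -sG imset_f.
    by case/imsetP=> z' z'A /fi -> //; [apply: (subsetP sV)|apply: (subsetP AK)].
  have : f z \in f @: s by rewrite sG -AG imset_f.
  by case/imsetP=> z' z's /fi -> //; [apply: (subsetP AK)|apply: (subsetP sV)].
have half c d (u v : T) : u \in vertices K -> v \in vertices K -> f u = Some c ->
  f v = Some d ->
    (forall G, G \in L -> d \notin G -> c |: G \in L) ->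
    forall F, F \in K -> v \notin F -> u |: F \in K.
  move=> uK vK fu fv h F FK vF; have [G GL FG] := fK F FK.
  have FV : F \subset vertices K by apply/subsetP=> z; apply: face_vertex FK.
  apply: (@reflect_ _ (c |: G)); first by rewrite subUset sub1set uK.
    apply: h => //; apply: contra vF => dG.
    have : Some d \in f @: F by rewrite FG mem_some_imset.
    by case/imsetP=> z zF; rewrite -fv => /fi -> //; apply: (subsetP FV).
  by rewrite imsetU1 FG fu -imsetU1.
exists x, y; split.
- by apply: contraNneq nab => xy; move: fx; rewrite xy fy => -[->].
- move=> F FK; split; first by apply: (half a b) => // G /ab[].
  by apply: (half b a) => // G /ab[].
- move=> abL; apply: reflect_ abL _; first by rewrite subUset !sub1set xK yK.
  by rewrite !imsetU1 !imset_set1 fx fy.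
Qed.

(** A pole is not a twin of a vertex adjacent to it: the two poles form a non-face, whereas the
    opposite pole alone is a face that misses that vertex. So both twins come from [K]. *)
Lemma suspension_twins (T : finType) (K : {set {set T}}) (a b : (bool + T)%type) :
  simplicial_complex K -> a != b -> twins a b (suspension K) ->
  [set a; b] \in suspension K ->
  exists x y, [/\ x != y, twins x y K & [set x; y] \in K].
Proof.
have pole e (c : (bool + T)%type) : simplicial_complex K ->
  twins (inl e) c (suspension K) ->
    c != inl e -> [set inl e; c] \in suspension K -> False.
  move=> [K0 _] ec nc; rewrite suspensionE !inE => /andP[cE _].
  have r0 e' (A : {set bool + T}) : A \subset [set inl e';
    inl (~~ e')] -> rights A = set0.
    move=> /subsetP AE; apply/setP=> x; rewrite !inE; apply/negP=> /AE.
    by rewrite !inE.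
  have eS : [set inl (~~ e)] \in suspension K.
    rewrite suspensionE (r0 e) ?subsetUr // K0 andbT !inE.
    by case: (e).
  have [/(_ _) + _] := ec _ eS; rewrite suspensionE !inE => h.
  have : c \notin [set inl (~~ e)].
    rewrite inE; apply: contraNneq cE => ->; case: (e); by rewrite !eqxx ?orbT.
  by rewrite inE => /h; case: (e); rewrite !eqxx ?orbT.
move=> Kc; case: a b => [e|x] [e'|y] nab ab abK.
- by case: (pole e (inl e')) => //; rewrite eq_sym.
- by case: (pole e (inr y)).
- by case: (pole e' (inr x)) => //; [apply: twins_sym|rewrite setUC].
have rI (A : {set T}) : rights (inr @: A : {set bool + T}) = A.
  by apply/setP=> z; rewrite inE mem_imset // => ? ? [].
have sI (A : {set T}) : (inr @: A : {set bool + T}) \in suspension K = (A \in K).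
  rewrite suspensionE rI; have nI e : (inl e \in [set inr x | x in A]) = false.
    by apply/imsetP=> -[].
  by rewrite !nI.
exists x, y; split; first by apply: contra nab => /eqP->.
  move=> F FK; have := ab (inr @: F); rewrite sI FK => /(_ isT).
  by rewrite -!imsetU1 !sI !mem_imset // => ? ? [].
by move: abK; rewrite -(imset_set1 inr y) -imsetU1 sI.
Qed.

(** * Purity under links, stellar subdivisions, isomorphisms and twins *)

Definition pure_of_size (T : finType) (K : {set {set T}}) (d : nat) : Prop :=
  forall s, s \in K ->
    #|s| <= d /\ exists t : {set T}, [/\ t \in K, s \subset t & #|t| = d].

Lemma pureP (T : finType) (K : {set {set T}}) : simplicial_complex K ->
  pure K <-> exists d, pure_of_size K d.
Proof.
move=> [K0 Kd]; split=> [Kp|[d Kd' s t fs ft]]; last first.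
  have sz r : facet K r -> #|r| = d.
    move=> /maxsetP[rK rmax]; have [_ [r' [r'K rr' <-]]] := Kd' r rK.
    by rewrite (rmax r').
  by rewrite !sz.
have [m mf _] := maxset_exists K0; exists #|m| => s sK.
have [t tf st] := maxset_exists sK; rewrite (Kp m t) //.
by split; [apply: subset_leq_card|exists t; split=> //; case/maxsetP: tf].
Qed.

Lemma pure_link (T : finType) (K : {set {set T}}) (v : T) :
  simplicial_complex K -> [set v] \in K -> pure K -> pure (link K [set v]).
Proof.
move=> Kc vK /(pureP Kc)[d Kd]; apply/(pureP (link1_complex Kc vK)).
exists d.-1 => s; rewrite link1E // => /andP[vs vsK].
have [le [t [tK vst td]]] := Kd _ vsK; move: le; rewrite cardsU1 vs add1n => le.
have vt : v \in t by apply: (subsetP vst); rewrite !inE eqxx.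
split; first by rewrite -ltnS (ltn_predK le).
exists (t :\ v); split.
- by rewrite link1E // !inE eqxx setD1K.
- apply/subsetP=> x xs; rewrite !inE (subsetP vst) ?inE ?xs ?orbT // andbT.
  by apply: contraNneq vs => <-.
- by rewrite -td (cardsD1 v t) vt.
Qed.

(** Extend the underlying face of [K] to a face [t] of full size. If [t] does not contain [s], it
    survives the subdivision; otherwise some [x] in [s] is missing from the given face, and the
    center replaces [x] in [t]. *)
Lemma pure_stell (T : finType) (K : {set {set T}}) (s : {set T}) :
  simplicial_complex K -> s != set0 -> pure K -> pure (stell s K).
Proof.
move=> Kc s0 /(pureP Kc)[d Kd]; apply/(pureP (stell_complex Kc s0)); exists d.
have szN (S : {set option T}) : #|S| = (None \in S) + #|somes S|.
  rewrite (cardsD1 None); congr (_ + _).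
  rewrite -(card_imset (somes S) (@Some_inj _)); apply: eq_card => -[x|];
    by rewrite mem_some_imset !inE.
move=> S; rewrite inE => /andP[/subsetPn[x xs xS] SK].
have [le [t [tK SKt td]]] := Kd _ SK.
have st : somes S \subset t by apply: subset_trans SKt; apply: subsetUl.
have [sst|nst] := boolP (s \subset t); last first.
  have NS : None \notin S.
    apply: contra nst => NS; apply: subset_trans SKt; rewrite NS; exact: subsetUr.
  split; first by rewrite szN (negPf NS) -td subset_leq_card.
  exists (Some @: t); split.
  - by rewrite inE somesK nst mem_some_imset setU0.
  - apply/subsetP=> -[y|]; rewrite ?(negPf NS) // mem_some_imset => yS.
    by rewrite (subsetP st) // inE.
  - by rewrite card_imset //; apply: Some_inj.
pose S' := None |: Some @: (t :\ x); have xt := subsetP sst x xs.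
have sS' : somes S' = t :\ x by rewrite somesU somes_set1N somesK set0U.
have S'd : #|S'| = d by rewrite szN sS' -td (cardsD1 x t) xt !inE eqxx.
have SS' : S \subset S'.
  apply/subsetP=> -[y|]; rewrite !inE // mem_some_imset !inE => yS.
  by rewrite (subsetP st) ?inE // andbT; apply: contraNneq xS => <-; rewrite inE.
split; first by rewrite -S'd subset_leq_card.
exists S'; split=> //; rewrite inE sS' !inE eqxx /=; apply/andP; split.
  by apply/subsetPn; exists x; rewrite // !inE eqxx.
by apply: Kc.2 tK _; rewrite subUset subD1set.
Qed.

Lemma pure_isomorphic (T U : finType) (K : {set {set T}}) (L : {set {set U}}) :
  simplicial_complex K -> simplicial_complex L -> isomorphic K L -> pure K ->
    pure L.
Proof.
move=> Kc Lc /isomorphicP[f [fi fK fL]] /(pureP Kc)[d Kd]; apply/(pureP Lc).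
exists d; have sz (s : {set T}) (t : {set U}) : s \in K -> f @: s = Some @: t ->
  #|s| = #|t|.
  move=> sK st; rewrite -(card_imset t (@Some_inj _)) -st card_in_imset //.
  by move=> x y xs ys; apply: fi; apply: face_vertex sK _.
move=> t /fL[s sK st]; rewrite -(sz _ _ sK st);
  have [le [s' [s'K ss' <-]]] := Kd s sK.
split; first exact: subset_leq_card.
have [t' t'L st'] := fK s' s'K; exists t'; split=> //;
  last by rewrite (sz _ _ s'K st').
apply/subsetP=> x xt; have : Some x \in f @: s'
  by rewrite (subsetP (imsetS f ss')) // st mem_some_imset.
by rewrite st' mem_some_imset.
Qed.

(** A face without [b] is carried into the star of [b] by replacing or ignoring [a], and is extended
    there to [b |: t]. If [t] contains [a], this already contains the face; if not, [b] is exchanged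
    for [a]. *)
Lemma pure_twins (T : finType) (K : {set {set T}}) (a b : T) :
  simplicial_complex K -> a != b -> twins a b K -> [set b] \in K ->
  pure (link K [set b]) -> pure K.
Proof.
move=> Kc nab ab bK /(pureP (link1_complex Kc bK))[d Ld]; apply/(pureP Kc).
exists d.+1 => F FK; have [bF|bF] := boolP (b \in F).
  have := Ld (F :\ b); rewrite link1E // setD1K // FK !inE eqxx.
  case=> // le [t [+ Ft td]]; rewrite link1E // => /andP[bt tK].
  split; first by rewrite (cardsD1 b) bF.
  by exists (b |: t); rewrite tK cardsU1 bt td -subDset.
have := Ld (F :\ a); rewrite link1E // !inE (negPf bF) andbF /=.
have e : F :\ a :\ b = F :\ a.
  by apply/setP=> x; rewrite !inE; case: eqVneq => //= ->;
    rewrite (negPf bF) andbF.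
have -> : b |: (F :\ a) \in K.
  by rewrite -e twins_mem // (negPf bF) andbF.
case=> // le [t [+ Ft td]]; rewrite link1E // => /andP[bt tK].
split; first by rewrite (cardsD1 a); case: (a \in F);
  rewrite ?ltnS // (leq_trans le).
have Fat : F \subset a |: t by rewrite -subDset.
have [at_|at_] := boolP (a \in t).
  exists (b |: t); rewrite tK cardsU1 bt td; split=> //.
  apply: subset_trans Fat _; rewrite subUset sub1set !inE at_ orbT /=.
  exact: subsetUr.
exists (a |: t); rewrite cardsU1 at_ td; split=> //.
by apply: (ab t _).1 bt; apply: Kc.2 tK (subsetUr _ _).
Qed.

(** * The J-construction with multiplicities at most two *)

Section Doubling.
Variable T : finType.
Implicit Types (D A : {set T}) (F : {set T * bool}) (K : {set {set T}}).

Definition core D F : {set T} :=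
  [set v | ((v, false) \in F) && ((v \in D) ==> ((v, true) \in F))].

(* The [J]-construction with [J v = 2] on [D] and [J v = 1] elsewhere. *)
Definition doubling D K : {set {set T * bool}} :=
  [set F : {set T * bool} | [forall v, ((v, true) \in F) ==> (v \in D)] && (core
    D F \in K)].

Lemma doublingP D K F : reflect
  ((forall v, (v, true) \in F -> v \in D) /\ core D F \in K) (F \in doubling D K).
Proof.
rewrite inE; apply: (iffP andP) => -[h cK]; split=> //.
  by move=> v; apply/implyP/(forallP h).
by apply/forallP=> v; apply/implyP/h.
Qed.

Lemma coreS D F F' : F \subset F' -> core D F \subset core D F'.
Proof.
move=> /subsetP FF'; apply/subsetP=> v; rewrite !inE => /andP[/FF'-> /=].
by case: (v \in D) => //= /FF'.
Qed.

Lemma doubling_complex D K :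
  simplicial_complex K -> simplicial_complex (doubling D K).
Proof.
move=> [K0 Kd]; split.
  apply/doublingP; split=> [v|]; rewrite ?inE //.
  by congr (_ \in K): K0; apply/setP=> v; rewrite !inE.
move=> F F' /doublingP[FD FK] F'F; apply/doublingP; split.
  by move=> v /(subsetP F'F)/FD.
exact: Kd FK (coreS D F'F).
Qed.

Lemma doubling_twins D K v : simplicial_complex K -> v \in D ->
  twins (v, false) (v, true) (doubling D K).
Proof.
move=> [_ Kd] vD F /doublingP[FD FK]; split=> nF; apply/doublingP; split.
- by move=> u; rewrite !inE /= xpair_eqE andbF => /FD.
- apply: Kd FK _; apply/subsetP=> u; rewrite !inE !xpair_eqE andbF andbT /=.
  by case: eqVneq => // ->; rewrite vD (negPf nF).
- by move=> u; rewrite !inE xpair_eqE andbT => /orP[/eqP->|/FD].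
- apply: Kd FK _; apply/subsetP=> u; rewrite !inE !xpair_eqE andbF andbT /=.
  by case: eqVneq => // ->; rewrite (negPf nF).
Qed.

Lemma doubling_vertex D K v : simplicial_complex K -> v \in D ->
  [set (v, true)] \in doubling D K.
Proof.
move=> [K0 _] vD; apply/doublingP; split.
  by move=> u; rewrite inE xpair_eqE andbT => /eqP->.
congr (_ \in K): K0; apply/setP=> u; rewrite !inE !xpair_eqE /=.
by rewrite andbF.
Qed.

Lemma doubling_link D K v : simplicial_complex K -> v \in D ->
  link (doubling D K) [set (v, true)] = doubling (D :\ v) K.
Proof.
move=> Kc vD; apply/setP=> F; rewrite link1E; last exact: doubling_complex.
have e : (v, true) \notin F -> core D ((v, true) |: F) = core (D :\ v) F.
  move=> vF; apply/setP=> u; rewrite !inE !xpair_eqE andbF andbT /=.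
  by case: eqVneq => [->|]; rewrite ?vD ?andbT.
apply/andP/doublingP=> [[vF /doublingP[FD FK]]|[FD FK]].
  split; last by rewrite -e.
  move=> u uF; rewrite !inE FD ?andbT ?inE ?uF ?orbT //.
  by apply: contraNneq vF => <-.
have vF : (v, true) \notin F by apply/negP=> /FD; rewrite !inE eqxx.
split=> //; apply/doublingP; rewrite e //; split=> // u.
by rewrite !inE xpair_eqE andbT => /orP[/eqP->//|/FD]; rewrite inE => /andP[].
Qed.

Lemma doubling0_isomorphic K : isomorphic K (doubling set0 K).
Proof.
pose f (v : T) := (v, false).
pose g (x : T * bool) := if x.2 then None else Some x.1.
have fg : pcancel f g by [].
have gf : ocancel g f by case=> v [].
apply: (isomorphic_pcan fg gf).
  by move=> t [v []] // /doublingP[tD _] /tD; rewrite inE.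
move=> s; apply/doublingP/idP=> [[_]|sK].
  congr (_ \in K); apply/setP=> v; rewrite !inE /= andbT.
  by rewrite (mem_imset_pcan _ _ fg gf).
split; first by move=> v; rewrite (mem_imset_pcan _ _ fg gf).
congr (_ \in K): sK; apply/setP=> v; rewrite !inE /= andbT.
by rewrite (mem_imset_pcan _ _ fg gf).
Qed.

(** [zero_copies D] is the assembled face, since its copies will be labelled [false]. The other two
    produce test faces with core [A]: [last_copies D A] holds the one copy of each element of [A]
    that is not a zero copy, and has core [A] once the zero copies are added. *)
Definition zero_copies D : {set T * bool} := [set x | (x.1 \in D) && ~~ x.2].
Definition full_copies D A : {set T * bool} :=
  [set x | (x.1 \in A) && (x.2 ==> (x.1 \in D))].
Definition last_copies D A : {set T * bool} :=
  [set x | (x.1 \in A) && (x.2 == (x.1 \in D))].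

Lemma core_full D A : core D (full_copies D A) = A.
Proof. by apply/setP=> v; rewrite !inE /=; case: (v \in A); case: (v \in D). Qed.

Lemma core_last D A : core D (last_copies D A :|: zero_copies D) = A.
Proof. by apply/setP=> v; rewrite !inE /=; case: (v \in A); case: (v \in D). Qed.

Lemma full_doubling D K A :
  (full_copies D A \in doubling D K) = (A \in K).
Proof.
apply/doublingP/idP; rewrite core_full; first by case.
by split=> // v; rewrite !inE => /andP[].
Qed.

Lemma last_doubling D K A :
  (last_copies D A :|: zero_copies D \in doubling D K) = (A \in K).
Proof.
apply/doublingP/idP; rewrite core_last; first by case.
by split=> // v; rewrite !inE /= andbF orbF => /andP[_ /eqP <-].
Qed.

Section Twins.
Variables (D : {set T}) (K : {set {set T}}).
Hypothesis Kc : simplicial_complex K.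

Local Notation S := (zero_copies D).
Local Notation M := (stell S (doubling D K)).

Let old (F : {set T * bool}) : {set option (T * bool)} := Some @: F.
Let new (F : {set T * bool}) : {set option (T * bool)} := None |: Some @: F.

Lemma mem_old_stell F :
  (old F \in M) = ~~ (S \subset F) && (F \in doubling D K).
Proof. by rewrite [LHS]inE somesK mem_some_imset setU0. Qed.

Lemma mem_new_stell F :
  (new F \in M) = ~~ (S \subset F) && (F :|: S \in doubling D K).
Proof. by rewrite [LHS]inE somesU somes_set1N somesK set0U !inE eqxx. Qed.

Lemma some_in_old x F : (Some x \in old F) = (x \in F).
Proof. by rewrite mem_some_imset. Qed.

Lemma some_in_new x F : (Some x \in new F) = (x \in F).
Proof. by rewrite !inE mem_some_imset. Qed.

Lemma oldU1 x F : Some x |: old F = old (x |: F).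
Proof. by rewrite /old imsetU1. Qed.

Lemma newU1 x F : Some x |: new F = new (x |: F).
Proof. by rewrite /new imsetU1 setUCA. Qed.

Lemma zero_copiesD1 x : x \in S -> old (S :\ x) \in M.
Proof.
move=> xS; rewrite mem_old_stell; apply/andP; split.
  by apply/subsetPn; exists x; rewrite // !inE eqxx.
apply/doublingP; split=> [v|]; first by rewrite !inE /= !andbF.
congr (_ \in K): (Kc.1); apply/setP=> v; rewrite !inE /= !andbF andbT.
by case: (v \in D); rewrite ?andbF.
Qed.

(** [S] is not a face of [M] but [S :\ x] is, so every twin of [x] has to lie in [S :\ x]. *)
Lemma zero_copies_twins x b : x \in S -> b \notin old (S :\ x) ->
  twins (Some x) b M -> False.
Proof.
move=> xS bS /(_ _ (zero_copiesD1 xS))[/(_ bS)]; rewrite oldU1 setD1K //.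
by rewrite mem_old_stell subxx.
Qed.

(* [full_copies D (v |: A)] with one copy of [v] removed is a face when [A] is. *)
Lemma full_copies_twins v x b A : x.1 = v -> x \in full_copies D (v |: A) ->
  twins (Some x) b M -> A \in K -> ~~ (S \subset full_copies D (v |: A) :\ x) ->
  b \notin old (full_copies D (v |: A) :\ x) -> v |: A \in K.
Proof.
move=> xv xF xb AK SF bF; have FM : old (full_copies D (v |: A) :\ x) \in M.
  rewrite mem_old_stell SF; apply/doublingP; split.
    by move=> u; rewrite !inE /= => /and3P[].
  apply: Kc.2 AK _; apply/subsetP=> u; rewrite !inE /= andbT.
  case: x xv xF {xb SF bF} => v' e /= ->; rewrite !inE !xpair_eqE /= eqxx /=.
  have [->|] //= := eqVneq u v; last by move=> _ _ /andP[].
  by case: e; case: (v \in D).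
have [/(_ bF)] := xb _ FM.
by rewrite oldU1 setD1K // mem_old_stell => /andP[_]; rewrite full_doubling.
Qed.

(** Next to the center the zero copies count as present, so the last copy of [v] alone completes
    [v]. The element [d] ensures that the test face does not itself contain [S]. *)
Lemma last_copies_twins v b A d : d \in D ->
  twins (Some (v, v \in D)) b M -> A \in K ->
  b \notin new (last_copies D A) -> v |: A \in K.
Proof.
move=> dD vb AK bA; have FM : new (last_copies D A) \in M.
  rewrite mem_new_stell last_doubling AK andbT.
  by apply/subsetPn; exists (d, false); rewrite !inE dD //= andbF.
have [/(_ bA)] := vb _ FM; rewrite newU1 mem_new_stell.
have -> : (v, v \in D) |: last_copies D A = last_copies D (v |: A).
  apply/setP=> -[u e]; rewrite !inE xpair_eqE /=.
  by case: eqVneq => [->|]; rewrite ?andbT //=; case: (e == _);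
    rewrite ?andbF ?orbT.
by move=> /andP[_]; rewrite last_doubling.
Qed.

Lemma legit_vertex x : [set Some x] \in M -> x \notin S -> x = (x.1, x.1 \in D).
Proof.
rewrite inE somes_set1 [None \in _]inE setU0 => /andP[_ /doublingP[xD _]].
case: x xD => v e /(_ v) /=; rewrite !inE xpair_eqE eqxx /=; case: e => /=.
  by move=> /(_ isT) ->.
by move=> _; case: (v \in D).
Qed.

(** A twin of the center lies outside [S], hence is the last copy of some [v]. Adding the center
    completes any doubled [d] whose last copy is present, adding [x] completes [v]; so [d] and [v]
    are twins for any doubled [d] other than [v], and [1 < #|D|] supplies one. *)
Lemma center_twins x : 1 < #|D| -> [set Some x] \in M -> twins None (Some x) M ->
  exists u v, u != v /\ twins u v K.
Proof.
move=> D2 xM Nx; have xS : x \notin S.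
  apply/negP=> xS; apply: (zero_copies_twins xS _ (twins_sym Nx)).
  by rewrite mem_some_imset.
have xE := legit_vertex xM xS; set v := x.1 in xE.
have /card_gt0P[d] : 0 < #|D :\ v| by rewrite (cardsD1 v) in D2; lia.
rewrite !inE => /andP[dv dD]; exists d, v; split=> // A AK; split=> [vA|dA].
  have xF : Some x \notin old (last_copies D (d |: A)).
    by rewrite some_in_old xE !inE /= eq_sym (negPf dv) (negPf vA).
  have FM : old (last_copies D (d |: A)) \in M.
    rewrite mem_old_stell; apply/andP; split.
      by apply/subsetPn; exists (d, false); rewrite !inE dD //= andbF.
    (* Without zero copies no element of [D] is in the core, in particular not [d]; so the core is
       contained in [A]. *)
    apply/doublingP; split=> [u|]; first by rewrite !inE => /andP[_ /eqP <-].
    apply: Kc.2 AK _; apply/subsetP=> u; rewrite !inE /=.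
    by case: eqVneq => [->|_]; rewrite ?dD ?andbF // => /andP[/andP[]].
  have [/(_ xF)] := Nx _ FM; rewrite -[_ |: _]/(new _) mem_new_stell => /andP[_].
  by rewrite last_doubling.
apply: (@full_copies_twins v x None) AK _ _ => //.
- by rewrite xE !inE /= eqxx implybb.
- exact: twins_sym.
- apply/subsetPn; exists (d, false); rewrite !inE ?dD //=.
  by rewrite (negPf dv) (negPf dA) andbF.
- by rewrite mem_some_imset.
Qed.

Lemma zero_copy_twins x y : x \in S -> y \in S -> x != y ->
  twins (Some x) (Some y) M ->
  forall A, A \in K -> y.1 \notin A -> x.1 |: A \in K.
Proof.
move=> xS yS xy xyM A AK yA; have yx : y.1 != x.1.
  apply: contraNneq xy => e; move: xS yS; rewrite !inE => /andP[_ x2] /andP[_ y2].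
  by rewrite [x]surjective_pairing [y]surjective_pairing e (negPf x2) (negPf y2).
have yF : y \notin full_copies D (x.1 |: A) :\ x.
  by rewrite !inE (negPf yx) (negPf yA) andbF.
apply: (@full_copies_twins _ x (Some y)) AK _ _ => //.
- by move: xS; rewrite !inE eqxx => /andP[-> _]; rewrite implybT.
- by apply/subsetPn; exists y.
- by rewrite some_in_old.
Qed.

Lemma last_copy_twins x y : 0 < #|D| -> x = (x.1, x.1 \in D) ->
  twins (Some x) (Some y) M ->
  forall A, A \in K -> y.1 \notin A -> x.1 |: A \in K.
Proof.
move=> /card_gt0P[d dD] xE xyM A AK yA; rewrite xE in xyM.
apply: last_copies_twins dD xyM AK _.
by rewrite some_in_new !inE (negPf yA).
Qed.

(** Two zero copies are compared on full sets of copies with one copy removed, two last copies on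
    faces through the center. A zero copy and a vertex outside [S] are told apart by [S] without
    that copy. *)
Lemma stell_doubling_twins a b : 1 < #|D| -> set0 \in M -> a != b ->
  twins a b M ->
  exists u v, u != v /\ twins u v K.
Proof.
move=> D2 M0 nab ab; have [aM bM] : [set a] \in M /\ [set b] \in M.
  by have := ab _ M0; rewrite !in_set0 => -[/(_ isT) + /(_ isT)]; rewrite !setU0.
have D0 : 0 < #|D| by apply: ltn_trans D2.
case: a b nab ab aM bM => [x|] [y|] nab ab xM yM //.
- have xy : x != y by apply: contra nab => /eqP->.
  have ba := twins_sym ab.
  have [xS|xS] := boolP (x \in S); have [yS|yS] := boolP (y \in S).
  + exists x.1, y.1; split; last first.
      move=> A AK; split; first exact: zero_copy_twins ab A AK.
      by apply: zero_copy_twins ba A AK; rewrite // eq_sym.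
    move: xS yS; rewrite !inE => /andP[_ x2] /andP[_ y2];
      apply: contra xy => /eqP e.
    by rewrite [x]surjective_pairing [y]surjective_pairing e (negPf x2) (negPf
      y2).
  + case: (zero_copies_twins xS _ ab).
    by rewrite some_in_old in_setD1 (negPf yS) andbF.
  + case: (zero_copies_twins yS _ ba).
    by rewrite some_in_old in_setD1 (negPf xS) andbF.
  + have xE := legit_vertex xM xS; have yE := legit_vertex yM yS.
    exists x.1, y.1; split; first by apply: contra xy => /eqP e; rewrite xE yE e.
    by move=> A AK; split; [apply: last_copy_twins ab A AK|apply: last_copy_twins
      ba A AK].
- exact: center_twins (twins_sym ab).
- exact: center_twins ab.
Qed.

End Twins.
End Doubling.

(** * From the J-construction to doublings on pairs *)

Lemma stell_isomorphic (T U : finType) (f : T -> U) (g : U -> option T)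
    (K : {set {set T}}) (L : {set {set U}}) (s : {set T}) :
  pcancel f g -> ocancel g f ->
  (forall (t : {set U}) u, t \in L -> u \in t -> g u) ->
  (forall s : {set T}, (f @: s \in L) = (s \in K)) ->
  isomorphic (stell s K) (stell (f @: s) L).
Proof.
move=> fg gf Lg KL.
pose f' := omap f; pose g' o := if o is Some u then omap Some (g u) else Some
  None.
have fg' : pcancel f' g' by case=> [x|] //=; rewrite fg.
have gf' : ocancel g' f' by case=> [u|] //=; have := gf u;
  case: (g u) => //= x ->.
have fS (A B : {set T}) : (f @: A \subset f @: B) = (A \subset B).
  apply/idP/idP=> [/subsetP h|/imsetS//]; apply/subsetP=> x xA.
  by have := h (f x) (imset_f _ xA); rewrite mem_imset //; apply: pcan_inj fg.
apply: (isomorphic_pcan fg' gf').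
  move=> t [u|] //; rewrite inE => /andP[_ tL] ut /=.
  have := Lg _ u tL; rewrite !inE ut /= => /(_ isT).
  by case: (g u).
move=> S; rewrite !inE (mem_imset_pcan _ _ fg' gf') /=.
have -> : somes (f' @: S) = f @: somes S.
  apply/setP=> u; rewrite inE (mem_imset_pcan _ _ fg' gf') (mem_imset_pcan _ _ fg
    gf) /=.
  by case: (g u) => //= x; rewrite inE.
rewrite fS -KL imsetU; congr (_ && (_ :|: _ \in L)).
by case: ifP; rewrite ?imset0.
Qed.

Lemma J_constructionE (T : finType) (K : {set {set T}}) (J : T ->
  nat) (s : {set copies J}) :
  simplicial_complex K ->
  (s \in J_construction K J) = ([set v | [forall i : 'I_(J v), copy i \in s]] \in
    K).
Proof.
move=> [_ Kd]; set A := [set v | _].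
have AS w : (all_copies J w \subset s) = (w \subset A).
  apply/subsetP/subsetP=> [h v vw|h [v i]].
    by rewrite inE; apply/forallP=> i; apply: h; rewrite inE.
  by rewrite inE => /h; rewrite inE => /forallP/(_ i).
rewrite inE; apply/forallP/idP=> [h|AK w].
  apply: contraT => AK.
  have [w wmin wA] := minset_exists (P := fun t => t \notin K) AK.
  by have := h w; rewrite /minimal_nonface wmin AS wA.
apply/implyP=> /minsetP[wK _]; rewrite AS; apply: contra wK => wA.
exact: Kd AK wA.
Qed.

Lemma J_construction_complex (T : finType) (K : {set {set T}}) (J : T -> nat) :
  simplicial_complex K -> (forall v, 0 < J v) ->
    simplicial_complex (J_construction K J).
Proof.
move=> Kc J0; split.
  rewrite J_constructionE //; congr (_ \in K): (Kc.1); apply/setP=> v;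
    rewrite !inE.
  by apply/esym/negP=> /forallP/(_ (Ordinal (J0 v))); rewrite inE.
move=> s t; rewrite !J_constructionE // => sK ts; apply: Kc.2 sK _.
apply/subsetP=> v; rewrite !inE => /forallP h; apply/forallP=> i.
exact: (subsetP ts).
Qed.

Section JDoubling.
Variables (T : finType) (J : T -> nat) (s : forall v, 'I_(J v)).
Hypothesis J_le2 : forall v, J v <= 2.

(** The label is relative to [s]: the selected copy gets [false] whatever its index, so that every
    assembled face becomes [zero_copies]. The inverse is partial because there is no second copy
    when [J v = 1]. *)
Definition to_pair (x : copies J) : T * bool := (tag x, tagged x != s (tag x)).
Definition of_pair (x : T * bool) : option (copies J) :=
  if x.2 then omap (@copy T J x.1) [pick i | i != s x.1] else Some (copy (s x.1)).

Lemma other_copy v (i i' : 'I_(J v)) : i != s v -> i' != s v -> i = i'.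
Proof.
move=> /eqP/val_eqP/= is_ /eqP/val_eqP/= i's; apply/val_inj => /=.
have := ltn_ord i; have := ltn_ord i'; have := ltn_ord (s v); have := J_le2 v.
lia.
Qed.

Lemma to_pairK : pcancel to_pair of_pair.
Proof.
case=> v i; rewrite /to_pair /of_pair /=; case: eqVneq => [->//|iv] /=.
case: pickP => [i' i'v|/(_ i)]; last by rewrite iv.
by rewrite (other_copy iv i'v).
Qed.

Lemma of_pairK : ocancel of_pair to_pair.
Proof.
case=> v [] /=; rewrite /of_pair /to_pair /=; last by rewrite eqxx.
by case: pickP => //= i ->.
Qed.

Lemma of_pair_doubled v : 1 < J v -> of_pair (v, true).
Proof.
move=> Jv; rewrite /of_pair /=; case: pickP => //= h.
have := h (Ordinal Jv); have := h (Ordinal (ltnW Jv)) => /=.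
by move=> /negbFE/eqP <- /negbFE/eqP/(congr1 val).
Qed.

Lemma J_construction_doubling (K : {set {set T}}) (F : {set copies J}) :
  simplicial_complex K ->
  (to_pair @: F \in doubling [set v | 1 < J v] K) = (F \in J_construction K J).
Proof.
move=> Kc; rewrite J_constructionE //.
have e : core [set v | 1 < J v] (to_pair @: F) =
    [set v | [forall i : 'I_(J v), copy i \in F]].
  apply/setP=> v; rewrite !inE !(mem_imset_pcan _ _ to_pairK of_pairK)
    {1}/of_pair /=.
  apply/andP/forallP=> [[sF /implyP vF] i|h].
    have [->//|iv] := eqVneq i (s v).
    have Jv : 1 < J v.
      rewrite ltnNge; apply/negP=> Jv; case/eqP: iv; apply/val_inj => /=.
      by have := ltn_ord i; have := ltn_ord (s v); lia.
    have := vF Jv; rewrite /of_pair /=; case: pickP => //= i' i'v.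
    by rewrite (other_copy iv i'v).
  split=> //; apply/implyP=> /of_pair_doubled; rewrite /of_pair /=.
  by case: pickP => //= i _ _; apply: h.
apply/doublingP/idP; rewrite e; first by case.
move=> FK; split=> // v; rewrite (mem_imset_pcan _ _ to_pairK of_pairK) inE
  /of_pair /=.
case: pickP => //= i iv _; rewrite ltnNge; apply/negP=> Jv.
case/eqP: iv; apply/val_inj => /=.
by have := ltn_ord i; have := ltn_ord (s v); lia.
Qed.

Lemma doubling_of_pair K (t : {set T * bool}) x :
  t \in doubling [set v | 1 < J v] K -> x \in t -> of_pair x.
Proof.
case: x => v [] // /doublingP[tD _] /tD; rewrite inE; exact: of_pair_doubled.
Qed.

Lemma J_construction_isomorphic K : simplicial_complex K ->
  isomorphic (J_construction K J) (doubling [set v | 1 < J v] K).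
Proof.
move=> Kc; apply: (isomorphic_pcan to_pairK of_pairK).
  by move=> t x; apply: doubling_of_pair.
by move=> F; apply: J_construction_doubling.
Qed.

Lemma J_construction_stell_isomorphic K t : simplicial_complex K ->
  isomorphic (stell t (J_construction K J))
    (stell (to_pair @: t) (doubling [set v | 1 < J v] K)).
Proof.
move=> Kc; apply: (stell_isomorphic _ to_pairK of_pairK).
  by move=> F x; apply: doubling_of_pair.
by move=> F; apply: J_construction_doubling.
Qed.

Lemma assembled_face_pairs :
  to_pair @: assembled_face s = zero_copies [set v | 1 < J v].
Proof.
apply/setP=> -[v e]; rewrite !inE;
  apply/imsetP/andP=> [[_ /imsetP[u uJ ->]]|[vJ eF]].
  by rewrite /to_pair /= eqxx => -[-> ->]; rewrite inE in uJ.
exists (copy (s v)); first by apply/imsetP; exists v; rewrite ?inE.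
by rewrite /to_pair /= eqxx; case: e {vJ} eF.
Qed.

End JDoubling.

(** * Subdivisions through cones *)

Section Cones.
Local Open Scope ring_scope.
Variable R : realType.

Local Notation lin := (@linear_extension R _ _).

Definition cone (T : finType) (K : {set {set T}}) (x : {ffun T -> R}) : Prop :=
  (forall v, 0 <= x v) /\ support x \in K.

Definition point (T : finType) (v : T) : {ffun T -> R} :=
  [ffun u => (u == v)%:R].

(* A subdivision in which the images of the vertices are not normalized: the
   linear extension is a bijection of cones instead of realizations.  Radial
   projections are then linear. *)
Definition refines (U T : finType) (p : U -> {ffun T -> R})
    (K' : {set {set U}}) (K : {set {set T}}) : Prop :=
  [/\ simplicial_complex K',
      forall s, s \in K' -> exists2 t, t \in K &
        forall u, u \in s -> (forall v, 0 <= p u v) /\ support (p u) \subset t,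
      forall y z, cone K' y -> cone K' z -> lin p y = lin p z -> y = z
    & forall x, cone K x -> exists2 y, cone K' y & lin p y = x].

Lemma zero_ffunE (T : finType) (v : T) : (0 : {ffun T -> R}) v = 0.
Proof. exact: ffunE. Qed.

Lemma eq_lin (U T : finType) (p q : U -> {ffun T -> R}) (y : {ffun U -> R}) :
  (forall u, u \in support y -> p u = q u) -> lin p y = lin q y.
Proof.
move=> pq; apply/ffunP=> v; rewrite !ffunE; apply: eq_bigr => u _.
by have [->|yu] := eqVneq (y u) 0; [rewrite !mul0r | rewrite pq // inE].
Qed.

Lemma lin_point (U T : finType) (p : U -> {ffun T -> R}) (u : U) :
  lin p (point u) = p u.
Proof.
apply/ffunP=> v; rewrite ffunE (bigD1 u) //= big1 => [|w wu].
  by rewrite ffunE eqxx mul1r addr0.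
by rewrite ffunE (negPf wu) mul0r.
Qed.

Lemma lin_id (T : finType) (x : {ffun T -> R}) : lin (@point T) x = x.
Proof.
apply/ffunP=> v; rewrite ffunE (bigD1 v) //= big1 => [|w wv].
  by rewrite ffunE eqxx mulr1 addr0.
by rewrite ffunE eq_sym (negPf wv) mulr0.
Qed.

Lemma lin_comp (V U T : finType) (p : U -> {ffun T -> R})
    (q : V -> {ffun U -> R}) (y : {ffun V -> R}) :
  lin p (lin q y) = lin (fun u => lin p (q u)) y.
Proof.
apply/ffunP=> v; rewrite !ffunE.
under eq_bigr do rewrite ffunE mulr_suml.
rewrite exchange_big /=; apply: eq_bigr => w _; rewrite ffunE mulr_sumr.
by apply: eq_bigr => u _; rewrite mulrA.
Qed.

Lemma linD (U T : finType) (p : U -> {ffun T -> R}) (y z : {ffun U -> R}) :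
  lin p (y + z) = lin p y + lin p z.
Proof.
apply/ffunP=> v; rewrite !ffunE -big_split /=.
by apply: eq_bigr => u _; rewrite ffunE mulrDl.
Qed.

Definition scale (T : finType) (a : R) (x : {ffun T -> R}) : {ffun T -> R} :=
  [ffun v => a * x v].

Lemma linZ (U T : finType) (p : U -> {ffun T -> R}) (a : R) (y : {ffun U -> R}) :
  lin p (scale a y) = scale a (lin p y).
Proof.
apply/ffunP=> v; rewrite !ffunE mulr_sumr.
by apply: eq_bigr => u _; rewrite ffunE mulrA.
Qed.

Lemma lin0 (U T : finType) (p : U -> {ffun T -> R}) : lin p 0 = 0.
Proof.
apply/ffunP=> v; rewrite ffunE zero_ffunE big1 // => u _.
by rewrite zero_ffunE mul0r.
Qed.

Lemma lin_ge0 (U T : finType) (p : U -> {ffun T -> R}) (y : {ffun U -> R}) :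
  (forall u, 0 <= y u) -> (forall u, u \in support y -> forall v, 0 <= p u v) ->
  forall v, 0 <= lin p y v.
Proof.
move=> y0 p0 v; rewrite ffunE sumr_ge0 // => u _.
by have [->|yu] := eqVneq (y u) 0; [rewrite mul0r | rewrite mulr_ge0 ?p0 // inE].
Qed.

Lemma support_lin (U T : finType) (p : U -> {ffun T -> R}) (y : {ffun U -> R})
    (t : {set T}) :
  (forall u, u \in support y -> support (p u) \subset t) ->
  support (lin p y) \subset t.
Proof.
move=> pt; apply/subsetP=> v; rewrite inE; apply: contraR => vt.
rewrite ffunE big1 // => u _.
have [->|yu] := eqVneq (y u) 0; first by rewrite mul0r.
have [->|puv] := eqVneq (p u v) 0; first by rewrite mulr0.
by case/negP: vt; apply: (subsetP (pt u _)); rewrite inE.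
Qed.

Lemma support0 (T : finType) : support (0 : {ffun T -> R}) = set0.
Proof. by apply/setP=> v; rewrite !inE zero_ffunE eqxx. Qed.

Lemma support_eq0 (T : finType) (x : {ffun T -> R}) : support x = set0 -> x = 0.
Proof.
move=> /setP x0; apply/ffunP=> v; have := x0 v.
by rewrite !inE zero_ffunE => /negbFE/eqP.
Qed.

Lemma support_point (T : finType) (v : T) : support (point v) = [set v].
Proof. by apply/setP=> u; rewrite !inE ffunE; case: (u == v);
  rewrite ?oner_eq0 ?eqxx. Qed.

Lemma supportD (T : finType) (x y : {ffun T -> R}) :
  support (x + y) \subset support x :|: support y.
Proof.
apply/subsetP=> v; rewrite !inE ffunE; apply: contraR.
by rewrite negb_or !negbK => /andP[/eqP-> /eqP->]; rewrite addr0.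
Qed.

Lemma supportZ (T : finType) (a : R) (x : {ffun T -> R}) :
  support (scale a x) \subset support x.
Proof.
apply/subsetP=> v; rewrite !inE ffunE; apply: contra => /eqP->.
by rewrite mulr0.
Qed.

Lemma cone_sub (T : finType) (K : {set {set T}}) (s : {set T}) (x : {ffun T ->
  R}) :
  simplicial_complex K -> s \in K -> (forall v, 0 <= x v) ->
  support x \subset s -> cone K x.
Proof. by move=> [_ Kd] sK x0 xs; split=> //; apply: Kd xs. Qed.

Lemma cone0 (T : finType) (K : {set {set T}}) : simplicial_complex K -> cone K 0.
Proof. by move=> [K0 _]; split=> [v|]; rewrite ?zero_ffunE ?support0. Qed.

Lemma point_ge0 (T : finType) (u v : T) : 0 <= point u v.
Proof. by rewrite ffunE ler0n. Qed.

Lemma cone_point (T : finType) (K : {set {set T}}) (v : T) :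
  [set v] \in K -> cone K (point v).
Proof. by split=> [u|]; rewrite ?point_ge0 ?support_point. Qed.

Lemma face_point (T : finType) (K : {set {set T}}) (s : {set T}) (v : T) :
  simplicial_complex K -> s \in K -> v \in s -> [set v] \in K.
Proof. by move=> [_ Kd] sK vs; apply: Kd sK _; rewrite sub1set. Qed.

Lemma coneZ (T : finType) (K : {set {set T}}) (a : R) (x : {ffun T -> R}) :
  simplicial_complex K -> 0 <= a -> cone K x -> cone K (scale a x).
Proof.
move=> Kc a0 [x0 xK]; apply: cone_sub xK _ (supportZ _ _) => // v.
by rewrite ffunE mulr_ge0.
Qed.

Section Refines.
Variables (U T : finType) (p : U -> {ffun T -> R}).
Variables (K' : {set {set U}}) (K : {set {set T}}).
Hypothesis Kc : simplicial_complex K.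

Lemma refines_cone (y : {ffun U -> R}) : refines p K' K -> cone K' y ->
  cone K (lin p y).
Proof.
move=> [_ pf _ _] [y0 yK]; have [t tK pt] := pf _ yK.
apply: cone_sub tK _ _ => //.
  by apply: lin_ge0 => // u /pt[].
by apply: support_lin => u /pt[].
Qed.

Lemma refines_image_face (s : {set U}) : refines p K' K -> s \in K' ->
  \bigcup_(u in s) support (p u) \in K.
Proof.
move=> [_ pf _ _] /pf[t tK pt]; case: Kc => _; apply; first exact: tK.
by apply/bigcupsP=> u /pt[].
Qed.

Lemma refines_neq0 (u : U) : refines p K' K -> [set u] \in K' -> p u != 0.
Proof.
move=> [K'c _ inj _] uK; apply/eqP => pu.
have := inj _ _ (cone_point uK) (cone0 K'c).
rewrite lin_point lin0 => /(_ pu) /ffunP/(_ u) /eqP.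
by rewrite zero_ffunE ffunE eqxx oner_eq0.
Qed.

End Refines.

Lemma refines_trans (V U T : finType) (p : U -> {ffun T -> R})
    (q : V -> {ffun U -> R}) K'' K' K :
  simplicial_complex K -> refines p K' K -> refines q K'' K' ->
  refines (fun u => lin p (q u)) K'' K.
Proof.
move=> Kc rp rq; have [K'c pf pi ps] := rp; have [K''c qf qi qs] := rq.
split=> //.
- move=> s sK; have [t tK qt] := qf s sK; have [t' tK' pt] := pf t tK.
  exists t' => // u us; have [q0 qut] := qt u us; split.
    by apply: lin_ge0 => // v /(subsetP qut)/pt[].
  by apply: support_lin => v /(subsetP qut)/pt[].
- move=> y z yK zK; rewrite -!lin_comp => /pi e; apply: qi => //.
  by apply: e; apply: refines_cone rq _.
- move=> x /ps[y yK <-]; have [z zK <-] := qs _ yK.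
  by exists z => //; rewrite lin_comp.
Qed.

Lemma refines_id (T : finType) (K : {set {set T}}) :
  simplicial_complex K -> refines (@point T) K K.
Proof.
move=> Kc; split=> //.
- move=> s sK; exists s => // u us; split; first exact: point_ge0.
  by rewrite support_point sub1set.
- by move=> y z _ _; rewrite !lin_id.
- by move=> x xK; exists x => //; rewrite lin_id.
Qed.

(** Since [lin p] after [lin r] is [lin q], injectivity of [lin r] comes from [lin q], and
    surjectivity from [lin q] together with injectivity of [lin p]. Only a facewise lift of the
    vertices has to be found. *)
Lemma refines_factor (M S T : finType) (q : M -> {ffun T -> R})
    (p : S -> {ffun T -> R}) (r : M -> {ffun S -> R}) KM KS K :
  simplicial_complex K -> simplicial_complex KS ->
  refines q KM K -> refines p KS K ->
  (forall s, s \in KM -> exists2 t, t \in KS & forall u, u \in s ->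
     [/\ forall v, 0 <= r u v, support (r u) \subset t & lin p (r u) = q u]) ->
  refines r KM KS.
Proof.
move=> Kc KSc rq rp rr; have [KMc qf qi qs] := rq; have [_ pf pi ps] := rp.
have e y : cone KM y -> lin p (lin r y) = lin q y.
  move=> [_ yK]; rewrite lin_comp; apply: eq_lin => u uy.
  by have [t _ /(_ u uy)[]] := rr _ yK.
have f s : s \in KM -> exists2 t, t \in KS & forall u, u \in s ->
    (forall v, 0 <= r u v) /\ support (r u) \subset t.
  by move=> /rr[t tK rt]; exists t => // u /rt[].
have ry y : cone KM y -> cone KS (lin r y).
  move=> [y0 yK]; have [t tK rt] := f _ yK; apply: cone_sub tK _ _ => //.
    by apply: lin_ge0 => // u /rt[].
  by apply: support_lin => u /rt[].
split=> //.
- by move=> y z yK zK yz; apply: qi => //; rewrite -!e // yz.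
- move=> x xK; have [y yK yx] := qs _ (refines_cone Kc rp xK).
  exists y => //; apply: pi => //; first exact: ry.
  by rewrite e.
Qed.

End Cones.

(** * Stellar subdivisions have common refinements with arbitrary ones *)

Section Geometry.
Local Open Scope ring_scope.
Variable R : realType.

Local Notation lin := (@linear_extension R _ _).

Lemma isomorphic_refines (T U : finType) (K : {set {set T}}) (L : {set {set U}}) :
  simplicial_complex K -> isomorphic K L ->
  exists p : T -> {ffun U -> R}, refines p K L.
Proof.
move=> Kc /isomorphicP[f [fi fK fL]].
(* The default [0] is taken only at elements that are not vertices of [K]. *)
pose p x : {ffun U -> R} := if f x is Some u then point R u else 0.
have ev (y : {ffun T -> R}) x u : cone K y -> x \in vertices K -> f x = Some u ->
    lin p y u = y x.
  move=> [y0 yK] xK fx; rewrite ffunE (bigD1 x) //= big1 => [|w wx].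
    by rewrite /p fx ffunE eqxx mulr1 addr0.
  have [->|yw] := eqVneq (y w) 0; first by rewrite mul0r.
  have wK : w \in vertices K by apply: face_vertex yK _ => //; rewrite inE.
  rewrite /p; case fw: (f w) => [u'|]; last by rewrite zero_ffunE mulr0.
  rewrite ffunE; case: eqP => [e|_]; last by rewrite mulr0.
  by case/eqP: wx; apply: fi; rewrite // fw fx e.
have fv (s : {set T}) (t : {set U}) x : f @: s = Some @: t -> x \in s ->
  exists2 u, u \in t & f x = Some u.
  move=> st xs; have : f x \in Some @: t by rewrite -st imset_f.
  by rewrite mem_some_imset; case: (f x) => // u; exists u.
exists p; split=> //.
- move=> s sK; have [t tL st] := fK s sK; exists t => // x xs.
  have [u ut fx] := fv _ _ _ st xs; rewrite /p fx; split; first exact: point_ge0.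
  by rewrite support_point sub1set.
- move=> y z yK zK yz; apply/ffunP=> x.
  have zero (y' : {ffun T -> R}) : cone K y' -> x \notin vertices K -> y' x = 0.
    move=> [_ yK']; apply: contraNeq => yx.
    by apply: (face_vertex Kc yK'); rewrite inE.
  have [xK|xK] := boolP (x \in vertices K); last by rewrite !zero.
  have := xK; rewrite inE => /fK[t tL st].
  have [u _ fx] := fv _ _ _ st (set11 x).
  by rewrite -(ev y x u) // -(ev z x u) // yz.
- move=> x [x0 xL]; have [s sK st] := fL _ xL.
  have [fs fs'] : (forall w, w \in s ->
    exists2 u, u \in support x & f w = Some u) /\
     (forall u, u \in support x -> exists2 w, w \in s & f w = Some u).
    split=> [w ws|u us]; first exact: fv st ws.
    have : Some u \in f @: s by rewrite st mem_some_imset.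
    by case/imsetP=> w ws e; exists w.
  pose y : {ffun T -> R} := [ffun w =>
    if w \in s then (if f w is Some u then x u else 0) else 0].
  have yK : cone K y.
    apply: cone_sub sK _ _ => // [w|].
      by rewrite ffunE; case: ifP => // _; case: (f w).
    by apply/subsetP=> w; rewrite inE ffunE; case: ifP => //; rewrite eqxx.
  exists y => //; apply/ffunP=> u; have [xu|xu] := eqVneq (x u) 0; last first.
    have [|w ws fw] := fs' u; first by rewrite inE.
    by rewrite (ev y w u) // ?(face_vertex Kc sK) // ffunE ws fw.
  rewrite ffunE xu big1 // => w _; rewrite ffunE; case: ifP => [ws|];
    last by rewrite mul0r.
  have [u' u's fw] := fs w ws; rewrite fw /p fw ffunE.
  by case: eqP u's => [<-|]; rewrite ?mulr0 // inE xu eqxx.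
Qed.

Definition centered (T : finType) (w : {ffun T -> R}) (o : option T) : {ffun T ->
  R} :=
  if o is Some v then point R v else w.

Lemma lin_centered (T : finType) (w : {ffun T -> R}) (y : {ffun option T ->
  R}) v :
  lin (centered w) y v = y (Some v) + y None * w v.
Proof.
rewrite ffunE (bigD1 None) //= addrC; congr (_ + _).
rewrite (reindex_omap Some id) /=; last by case.
rewrite (bigD1 v) ?eqxx //= ffunE eqxx mulr1 big1 ?addr0 // => u /andP[_ uv].
by rewrite ffunE eq_sym (negPf uv) mulr0.
Qed.

(** The inverse of [lin (centered w)] over the region where [i] minimizes [x j / w j]: the largest
    multiple of [w] that leaves [x] nonnegative is split off, and this annihilates the coordinate
    [i]. *)
Definition uncenter (T : finType) (w x : {ffun T ->
  R}) (i : T) : {ffun option T -> R} :=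
  [ffun o => if o is Some v then x v - x i / w i * w v else x i / w i].

Lemma uncenterP (T : finType) (w x : {ffun T ->
  R}) (i : T) (y := uncenter w x i) :
  (forall v, 0 <= w v) -> (forall v, 0 <= x v) -> i \in support w ->
  (forall j, j \in support w -> x i / w i <= x j / w j) ->
  [/\ forall o, 0 <= y o, lin (centered w) y = x, i \notin somes (support y),
      somes (support y) \subset support x
    & None \in support y -> support w \subset support x].
Proof.
move=> w0 x0 iw ci; rewrite {}/y /uncenter; set c := x i / w i in ci *.
have wpos v : v \in support w -> 0 < w v.
  by move=> vw; rewrite lt_neqAle w0 andbT eq_sym; rewrite inE in vw.
have c0 : 0 <= c by rewrite divr_ge0.
have yge v : 0 <= x v - c * w v.
  have [wv|] := boolP (v \in support w); last by rewrite inE negbK => /eqP->;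
    rewrite mulr0 subr0.
  by rewrite subr_ge0 -ler_pdivlMr ?wpos // ci.
split.
- by case=> [v|]; rewrite ffunE.
- by apply/ffunP=> v; rewrite lin_centered !ffunE subrK.
- by rewrite !inE ffunE negbK /c divfK ?subrr // gt_eqF ?wpos.
- apply/subsetP=> v; rewrite !inE ffunE; apply: contra => /eqP xv.
  have := yge v; rewrite xv sub0r oppr_ge0 => h.
  by rewrite oppr_eq0 eq_le h mulr_ge0.
- rewrite inE ffunE => ci0; apply/subsetP=> v vw; rewrite inE gt_eqF //.
  have : 0 < x v / w v by apply: lt_le_trans (ci v vw);
    rewrite lt_neqAle eq_sym ci0.
  by rewrite pmulr_lgt0 // invr_gt0 wpos.
Qed.

Lemma stell_refines (T : finType) (w : {ffun T -> R}) (K : {set {set T}}) :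
  simplicial_complex K -> (forall v, 0 <= w v) -> support w != set0 ->
  refines (centered w) (stell (support w) K) K.
Proof.
move=> Kc w0 wn0; have Kd := Kc.2; split=> //; first exact: stell_complex.
- move=> S /[!inE] /andP[sS SK]; eexists; first exact: SK.
  case=> [v|] vS /=; split=> //; first exact: point_ge0.
    by rewrite support_point sub1set !inE vS.
  by rewrite vS subsetUr.
(* The support of [z] misses some [v] in the support of [w]. At [v] the image of [z] consists of its
   central part only, whereas that of [y] contains at least its central part. *)
- have key (y z : {ffun option T -> R}) : cone (stell (support w) K) y ->
  cone (stell (support w) K) z ->
      lin (centered w) y = lin (centered w) z -> y None <= z None.
    move=> [y0 _] [z0 /[!inE] /andP[/subsetPn[v vw vz] _]] yz.
    have wv : 0 < w v by rewrite lt_neqAle w0 andbT eq_sym; rewrite inE in vw.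
    have zv : z (Some v) = 0 by move: vz; rewrite !inE => /negbNE/eqP.
    have := congr1 (fun f : {ffun T -> R} => f v) yz;
      rewrite /= !lin_centered zv add0r => e.
    rewrite -(ler_pM2r wv) -e lerDr; exact: y0.
  move=> y z yK zK yz; apply/ffunP=> -[v|]; last first.
    by apply/eqP; rewrite eq_le (key y z) // (key z y).
  have eN : y None = z None by apply/eqP; rewrite eq_le (key y z) // (key z y).
  have := congr1 (fun f : {ffun T -> R} => f v) yz.
  by rewrite /= !lin_centered eN => /addIr.
- move=> x [x0 xK]; have [v0 v0w] := set0Pn _ wn0.
  case: (arg_minP (fun v => x v / w v) v0w) => i iw ci.
  have [y0 yx yi ys yN] := uncenterP w0 x0 iw ci.
  exists (uncenter w x i) => //; split=> //.
  rewrite inE; apply/andP; split; first by apply/subsetPn; exists i.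
  apply: Kd xK _; rewrite subUset ys.
  by case: ifP; rewrite ?sub0set // => /yN.
Qed.

(** * Cutting along hyperplanes *)

Definition pairing (T : finType) (h x : {ffun T -> R}) : R := \sum_v x v * h v.

Lemma pairing_lin (U T : finType) (p : U -> {ffun T -> R}) h y :
  pairing h (lin p y) = pairing [ffun u => pairing h (p u)] y.
Proof.
rewrite /pairing; under eq_bigr do rewrite ffunE mulr_suml.
rewrite exchange_big; apply: eq_bigr => u _; rewrite ffunE mulr_sumr.
by apply: eq_bigr => v _; rewrite mulrA.
Qed.

Lemma pairing_point (T : finType) (h : {ffun T -> R}) v :
  pairing h (point R v) = h v.
Proof.
rewrite /pairing (bigD1 v) //= ffunE eqxx mul1r big1 ?addr0 // => u uv.
by rewrite ffunE (negPf uv) mul0r.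
Qed.

Definition same_sign (T : finType) (g : T -> R) (s : {set T}) : Prop :=
  (forall u, u \in s -> 0 <= g u) \/ (forall u, u \in s -> g u <= 0).

Lemma same_sign_lin (V U T : finType) (p : U -> {ffun T -> R})
    (q : V -> {ffun U -> R}) (h : {ffun T -> R}) (s : {set V}) (t : {set U}) :
  (forall u, u \in s -> (forall v, 0 <= q u v) /\ support (q u) \subset t) ->
  same_sign (fun u => pairing h (p u)) t ->
  same_sign (fun u => pairing h (lin p (q u))) s.
Proof.
move=> qt; case=> ht; [left|right] => u us; have [q0 /subsetP qut] := qt u us;
  rewrite pairing_lin; last rewrite -oppr_ge0 -sumrN; apply: sumr_ge0 => v _;
  rewrite ffunE -?mulrN; (have [->|qv] := eqVneq (q u v) 0;
    first by rewrite mul0r);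
  by rewrite mulr_ge0 ?oppr_ge0 ?ht // qut // inE.
Qed.

Definition sign_changes (T : finType) (K : {set {set T}}) (h : {ffun T -> R}) :
    {set T * T} :=
  [set e | (h e.1 < 0) && (0 < h e.2) && ([set e.1; e.2] \in K)].

(* A stellar subdivision at the zero of [h] on an edge where [h] changes sign
   destroys this edge and creates no other such edge. *)
Lemma sign_refinement (T : finType) (K : {set {set T}}) (h : {ffun T -> R}) :
  simplicial_complex K ->
  exists (U : finType) (K' : {set {set U}}) (p : U -> {ffun T -> R}),
    refines p K' K /\ forall s, s \in K' ->
      same_sign (fun u => pairing h (p u)) s.
Proof.
have [n] := ubnP #|sign_changes K h|; elim: n => // n IHn in T K h *.
rewrite ltnS => hn Kc; have [bad0|[[u v]]] := set_0Vmem (sign_changes K h).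
  exists T, K, (@point R T); split; first exact: refines_id.
  move=> s sK; have [/existsP[u /andP[us hu]]|] := boolP [exists u, (u \in s) &&
    (h u < 0)].
    right=> v vs; rewrite pairing_point leNgt; apply/negP=> hv.
    have /negP[] : (u, v) \notin sign_changes K h by rewrite bad0 inE.
    rewrite inE hu hv /=; case: Kc => _; apply; first exact: sK.
    by rewrite subUset !sub1set us vs.
  rewrite negb_exists => /forallP sh; left=> u us; rewrite pairing_point leNgt.
  by have := sh u; rewrite us.
move=> uvb; have := uvb; rewrite inE /= => /andP[/andP[hu hv] uvK].
have uv : u != v by apply: contraTneq hu => ->; rewrite -leNgt ltW.
(* The zero of [h] on the edge: the weights [h v] at [u] and [- h u] at [v] are positive and
   [h v * h u - h u * h v = 0]. *)
pose w : {ffun T -> R} := [ffun x =>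
  if x == u then h v else if x == v then - h u else 0].
have w0 x : 0 <= w x.
  rewrite ffunE; case: ifP => _; first exact: ltW.
  by case: ifP => _ //; rewrite oppr_ge0 ltW.
have sw : support w = [set u; v].
  apply/setP=> x; rewrite !inE ffunE; case: (x == u) => /=;
    first by rewrite (gt_eqF hv).
  by case: (x == v); rewrite ?eqxx // oppr_eq0 (lt_eqF hu).
have wn0 : support w != set0 by apply/set0Pn; exists u; rewrite sw !inE eqxx.
have rw := stell_refines Kc w0 wn0.
pose h1 : {ffun option T -> R} := [ffun o => pairing h (centered w o)].
have h1S x : h1 (Some x) = h x by rewrite ffunE pairing_point.
have h1N : h1 None = 0.
  rewrite ffunE /pairing /= (bigD1 u) // (bigD1 v) 1?eq_sym //= big1 =>
    [|x /andP[xu xv]].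
    by rewrite !ffunE !eqxx eq_sym (negPf uv) /=; ring.
  by rewrite ffunE (negPf xu) (negPf xv) mul0r.
have [||U [K' [p [rp ps]]]] := IHn _ (stell (support w) K) h1; last 1 first.
- exists U, K', (fun x => lin (centered w) (p x)); split;
  first exact: refines_trans rw rp.
  move=> s /ps [] sp; [left|right] => x xs; have := sp x xs;
    rewrite pairing_lin //.
- apply: leq_trans hn; rewrite [X in (_ < X)%N](cardsD1 (u, v)) uvb ltnS.
  apply: leq_trans (leq_imset_card (fun e => (Some e.1, Some e.2)) _).
  apply/subset_leq_card/subsetP=> -[[x|] [y|]];
    rewrite inE /= ?h1S ?h1N ?ltxx ?andbF //.
  rewrite inE sw => /andP[/andP[hx hy]] /andP[] /subsetPn[z zuv].
  have -> : somes [set Some x; Some y] = [set x; y] by apply/setP=> i;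
    rewrite !inE.
  move=> zxy; rewrite !inE /= setU0 => xyK.
  apply/imsetP; exists (x, y) => //; rewrite !inE /= hx hy xyK !andbT.
  by apply: contra zxy => /eqP[-> ->].
- exact: stell_complex.
Qed.

Lemma sign_refinements (T : finType) (K : {set {set T}}) (hs : seq {ffun T ->
  R}) :
  simplicial_complex K ->
  exists (U : finType) (K' : {set {set U}}) (p : U -> {ffun T -> R}),
    refines p K' K /\ forall h s, h \in hs -> s \in K' ->
      same_sign (fun u => pairing h (p u)) s.
Proof.
move=> Kc; elim: hs => [|h hs [U [K' [p [rp ps]]]]].
  by exists T, K, (@point R T); split=> //; apply: refines_id.
have K'c : simplicial_complex K' by case: rp.
have [V [K'' [q [rq qs]]]] := sign_refinement [ffun u => pairing h (p u)] K'c.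
exists V, K'', (fun u => lin p (q u)); split; first exact: refines_trans rp rq.
move=> h' s; rewrite inE => /orP[/eqP->|h's] sK.
  by case: (qs s sK) => sq; [left|right] => u us; rewrite pairing_lin sq.
case: rq => _ qf _ _; have [t tK qt] := qf s sK.
exact: same_sign_lin qt (ps _ _ h's tK).
Qed.

(** On a face of [M] every comparison of two ratios [x i / w i] goes the same way at all vertices,
    so one index minimizes the ratio at all of them and the face lifts to the subdivision. The last
    conclusion, that both placements agree over [K], serves for links. *)
Lemma common_refinement (U T : finType) (p : U -> {ffun T -> R}) K' K
    (w : {ffun T -> R}) :
  simplicial_complex K -> refines p K' K ->
  (forall v, 0 <= w v) -> support w != set0 ->
  exists (V : finType) (M : {set {set V}}) (q : V -> {ffun U -> R})
         (r : V -> {ffun option T -> R}),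
    [/\ refines q M K', refines r M (stell (support w) K)
      & forall u, [set u] \in M -> lin p (q u) = lin (centered w) (r u)].
Proof.
move=> Kc rp w0 wn0; have K'c : simplicial_complex K' by case: rp.
have wpos v : v \in support w -> 0 < w v.
  by move=> vw; rewrite lt_neqAle w0 andbT eq_sym; rewrite inE in vw.
pose h (e : T * T) : {ffun U ->
  R} := [ffun u => p u e.1 * w e.2 - p u e.2 * w e.1].
have [V [M [q [rq qs]]]] := sign_refinements [seq h e | e <- enum {: T * T}] K'c.
pose x u := lin p (q u).
have hx e u : pairing (h e) (q u) = x u e.1 * w e.2 - x u e.2 * w e.1.
  rewrite /pairing /x !ffunE !mulr_suml -sumrB; apply: eq_bigr => z _.
  by rewrite ffunE; ring.
have {}qs i j s : s \in M -> same_sign (fun u => x u i * w j - x u j * w i) s.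
  move=> sM; have /(_ (h (i, j)) s _ sM) := qs.
  case=> [|sq|sq]; first by apply/mapP; exists (i, j); rewrite ?mem_enum.
    by left=> u /sq; rewrite hx.
  by right=> u /sq; rewrite hx.
have rpq := refines_trans Kc rp rq.
have [v0 v0w] := set0Pn _ wn0.
pose i u := [arg min_(j < v0 in support w) (x u j / w j)]%O.
have iP u : i u \in support w /\ forall j, j \in support w ->
  x u (i u) / w (i u) <= x u j / w j.
  by rewrite /i; case: arg_minP => // k kw km; split.
pose r u := uncenter w (x u) (i u).
have x0 s u : s \in M -> u \in s -> forall v, 0 <= x u v.
  by move=> sM us; case: rpq => _ f _ _; have [t _ /(_ u us)[]] := f s sM.
have rP u : [set u] \in M -> lin p (q u) = lin (centered w) (r u).
  move=> uM; have [iw ic] := iP u.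
  by have [_ -> _ _ _] := uncenterP w0 (x0 _ _ uM (set11 u)) iw ic.
exists V, M, q, r; split=> //.
apply: (refines_factor Kc (stell_complex Kc wn0) rpq (stell_refines Kc w0 wn0))
  => s sM.
pose X := \bigcup_(u in s) support (x u).
have XK : X \in K by exact: (refines_image_face Kc rpq sM).
have [k kw km] : exists2 k, k \in support w &
    forall u j, u \in s -> j \in support w -> x u k / w k <= x u j / w j.
  (* An index that minimizes the sum of the ratios over [s] minimizes each of them: a strict
     violation at one vertex would, the signs being equal, make the whole sum larger. *)
  case: (arg_minP (fun j => \sum_(u in s) x u j / w j) v0w) => k kw km.
  exists k => // u j us jw; have wk := wpos k kw; have wj := wpos j jw.
  have e v : (x v k / w k <= x v j / w j) = (x v k * w j - x v j * w k <= 0).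
    by rewrite ler_pdivrMr // mulrAC ler_pdivlMr // subr_le0.
  case: (qs k j s sM) => sg; last by rewrite e sg.
  rewrite leNgt; apply/negP=> lt; have := km j jw; rewrite leNgt => /negP; apply.
  rewrite (bigD1 u us) [ltRHS](bigD1 u us) /=; apply: ltr_leD lt _.
  apply: ler_sum => v /andP[vs _]; have := sg v vs.
  by rewrite subr_ge0 ler_pdivrMr // mulrAC ler_pdivlMr.
pose t := [set o : option T | if o is Some v then (v \in X) && (v != k) else
  support w \subset X].
have tX : somes t \subset X by apply/subsetP=> v; rewrite !inE => /andP[].
exists t.
  rewrite inE; apply/andP; split; first by apply/subsetPn; exists k;
    rewrite // !inE eqxx andbF.
  case: Kc => _; apply; first exact: XK.
  by rewrite subUset tX inE; case: ifP; rewrite ?sub0set.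
move=> u us; have [iw ic] := iP u; have ux := x0 s u sM us.
have sx : support (x u) \subset X by apply: bigcup_sup us.
have [y0 yx _ ys yN] := uncenterP w0 ux iw ic; rewrite -/(r u) in y0 yx ys yN.
(* [r] was fixed with a minimizer for each vertex; [uncenter] depends on the index only through the
   ratio, so the minimizer common to the face may replace it. *)
have rk : r u = uncenter w (x u) k.
  have e : x u (i u) / w (i u) = x u k / w k by apply/eqP; rewrite eq_le ic // km.
  by rewrite /r /uncenter e.
split=> //; apply/subsetP=> -[v|] vr; rewrite inE.
  rewrite (subsetP sx) ?(subsetP ys) ?inE //=; last by rewrite inE in vr.
  by apply: contraTneq vr => ->; rewrite rk;
    have [_ _ + _ _] := uncenterP w0 ux kw (km u ^~ us); rewrite !inE.
exact: subset_trans (yN vr) sx.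
Qed.
End Geometry.

(** * Links *)

Section Links.
Local Open Scope ring_scope.
Variable R : realType.

Local Notation lin := (@linear_extension R _ _).

Lemma unbounded_pigeonhole (S : finType) (A : S -> R -> Prop) :
  (forall B, exists N, B <= N /\ exists s, A s N) ->
  exists s, forall B, exists N, B <= N /\ A s N.
Proof.
move=> AN; apply: contrapT => nA.
have /choice[f fP] : forall s, exists B, forall N, B <= N -> ~ A s N.
  move=> s; apply: contrapT => nB; apply: nA; exists s => B.
  apply: contrapT => nN; apply: nB; exists B => N BN AsN.
  by apply: nN; exists N.
(* This sum exceeds all the thresholds [f s] at once. *)
have [N [le [s]]] := AN (\sum_s `|f s|); apply: fP; apply: le_trans le.
by apply: le_trans (ler_norm _) _; rewrite (bigD1 s) //= lerDl sumr_ge0.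
Qed.

(** Coordinates modulo the ray of [a], which send the star of [a] to its link. *)
Definition forget (T : finType) (a : T) (x : {ffun T -> R}) : {ffun T -> R} :=
  [ffun v => if v == a then 0 else x v].

Lemma lin_forget (U T : finType) (p : U -> {ffun T -> R}) a y :
  lin (fun u => forget a (p u)) y = forget a (lin p y).
Proof.
apply/ffunP=> v; rewrite !ffunE; case: ifP => va; last first.
  by apply: eq_bigr => u _; rewrite ffunE va.
by rewrite big1 // => u _; rewrite ffunE va mulr0.
Qed.

Lemma support_forget (T : finType) (a : T) (x : {ffun T -> R}) :
  support (forget a x) = support x :\ a.
Proof. by apply/setP=> v; rewrite !inE ffunE; case: (v == a); rewrite ?eqxx. Qed.

(* Surjectivity: for [x] over the link of [a], the points [x + N a] with [N]
   unbounded that lie over one fixed simplex force [b] to be a vertex of it,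
   since all of its barycentric coordinates then grow with [N]. *)
Lemma link_refines (U T : finType) (p : U -> {ffun T -> R}) M K a b c :
  simplicial_complex K -> refines p M K -> [set a] \in K -> [set b] \in M ->
  0 < c -> p b = scale c (point R a) ->
  refines (fun u => forget a (p u)) (link M [set b]) (link K [set a]).
Proof.
move=> Kc rp aK bM c0 pb; have [Mc pf pi ps] := rp.
have face_add (y : {ffun U -> R}) d s : b |: s \in M -> (forall u, 0 <= y u) ->
    support y \subset s -> 0 <= d -> cone M (y + scale d (point R b)).
  move=> sM y0 ys d0; apply: cone_sub sM _ _ => // [u|].
    by rewrite !ffunE addr_ge0 // mulr_ge0.
  rewrite (subset_trans (supportD _ _)) // setUC setUSS //.
  by rewrite (subset_trans (supportZ _ _)) // support_point.
split; first exact: link1_complex.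
- move=> s; rewrite link1E // => /andP[bs sM]; have [t tK pt] := pf _ sM.
  have at_ : a \in t.
    have [_ /subsetP] := pt b (setU11 _ _); apply.
    by rewrite pb inE !ffunE eqxx mulr1 gt_eqF.
  exists (t :\ a); first by rewrite link1E // setD1K // tK !inE eqxx.
  move=> u us; have [p0 put] := pt u (setU1r _ us); split.
    by move=> v; rewrite ffunE; case: ifP.
  by rewrite support_forget setSD.
- move=> y z [y0]; rewrite link1E // => /andP[by_ yM] [z0].
  rewrite link1E // => /andP[bz zM]; rewrite !lin_forget => yz.
  pose Y := lin p y; pose Z := lin p z.
  have Y0 : 0 <= Y a.
    have [t _ pt] := pf _ yM.
    by apply: lin_ge0 => // u uy; have [] := pt u (setU1r _ uy).
  have Z0 : 0 <= Z a.
    have [t _ pt] := pf _ zM.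
    by apply: lin_ge0 => // u uz; have [] := pt u (setU1r _ uz).
  (* The images of [y] and [z] differ at most at [a]. Adding multiples of [b], which lies over [a],
     makes both coordinates at [a] equal to [Y a + Z a] and stays within the star of [b]. *)
  have e : y + scale (Z a / c) (point R b) = z + scale (Y a / c) (point R b).
    apply: pi; [by apply: face_add yM _ _ _; rewrite ?divr_ge0 // ltW|
                by apply: face_add zM _ _ _; rewrite ?divr_ge0 // ltW|].
    rewrite !linD !linZ !lin_point pb -/Y -/Z.
    apply/ffunP=> v; have := congr1 (fun f : {ffun T -> R} => f v) yz.
    rewrite /= !ffunE -/Y -/Z; have [->|va] := eqVneq v a.
      by move=> _; rewrite !mulr1 !divfK ?gt_eqF // addrC.
    by rewrite !mulr0 => ->.
  apply/ffunP=> u; have := congr1 (fun f : {ffun U -> R} => f u) e.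
  rewrite /= !ffunE; have [->|ub] := eqVneq u b.
    by move: by_ bz; rewrite !inE !negbK => /eqP-> /eqP->.
  by rewrite !mulr0 !addr0.
- move=> x [x0]; rewrite link1E // => /andP[ax xK].
  pose A (s : {set U}) N := exists y, [/\ cone M y, support y = s &
    lin p y = x + scale N (point R a)].
  have [|s sA] := @unbounded_pigeonhole _ A.
    move=> B; exists (Num.max B 0); split; first by rewrite le_max lexx.
    have xBK : cone K (x + scale (Num.max B 0) (point R a)).
      apply: cone_sub xK _ _ => // [v|].
        by rewrite !ffunE addr_ge0 // mulr_ge0 // le_max lexx orbT.
      rewrite (subset_trans (supportD _ _)) // setUC setUSS //.
      by rewrite (subset_trans (supportZ _ _)) // support_point.
    by have [y yM yx] := ps _ xBK; exists (support y), y.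
  have [N1 [_ [y1 [[y10 y1M] y1s y1x]]]] := sA 0.
  have [N2 [N12 [y2 [[y20 y2M] y2s y2x]]]] := sA (N1 + 1).
  have y12 u : y1 u <= y2 u.
    rewrite leNgt; apply/negP=> lt.
    (* The three points are collinear and lie over one simplex, so their coordinates are affine in
       [N]. If [y2 u < y1 u], the coordinate at [u] is negative from this value of [N] on. *)
    have [N3 [N23 [y3 [[y30 y3M] y3s y3x]]]] := sA (N2 + (N2 - N1) * y1 u / (y1 u
      - y2 u)).
    have d0 : 0 < y1 u - y2 u by rewrite subr_gt0.
    have h0 : 0 <= (N2 - N1) * y1 u / (y1 u - y2 u).
      by rewrite divr_ge0 ?mulr_ge0 ?y10 ?(ltW d0) //; lra.
    have e : scale (N3 - N1) y2 = scale (N2 - N1) y3 + scale (N3 - N2) y1.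
      have sub (y : {ffun U -> R}) d : support y = s ->
        support (scale d y) \subset s.
        by move=> <-; apply: supportZ.
      apply: pi.
      - by apply: coneZ => //; lra.
      - apply: (@cone_sub _ _ _ s) => //; first by rewrite -y1s.
          by move=> v; rewrite !ffunE addr_ge0 // mulr_ge0 //; lra.
        by rewrite (subset_trans (supportD _ _)) // subUset !sub.
      rewrite linD !linZ y1x y2x y3x; apply/ffunP=> v; rewrite !ffunE; ring.
    have := congr1 (fun f : {ffun U -> R} => f u) e; rewrite /= !ffunE => {}e.
    have := y30 u; have := y10 u => y1u y3u.
    have : (N2 - N1) * y1 u <= (N3 - N2) * (y1 u - y2 u).
      by rewrite -ler_pdivrMr //; lra.
    nra.
  have vM : cone M (y2 - y1).
    apply: (@cone_sub _ _ _ s) => //; first by rewrite -y1s.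
      by move=> u; rewrite !ffunE subr_ge0.
    apply/subsetP=> u; rewrite inE !ffunE; apply: contraR => us.
    move: us (us); rewrite -{1}y1s -{1}y2s !inE !negbK => /eqP-> /eqP->.
    by rewrite subrr.
  (* Both sides lie over [N2 - N1] times the point of [a]. As this factor is positive, [y2] is
     positive at [b], hence [b] belongs to [s]. *)
  have v_eq : y2 - y1 = scale ((N2 - N1) / c) (point R b).
    apply: pi => //.
      by apply: coneZ; rewrite ?divr_ge0 ?(ltW c0) //; [lra|apply: cone_point].
    have : lin p (y2 - y1) + lin p y1 = lin p y2 by rewrite -linD subrK.
    rewrite y1x y2x linZ lin_point pb => e; apply/ffunP=> v.
    have := congr1 (fun f : {ffun T -> R} => f v) e.
    rewrite /= [(lin p _ + _) v]ffunE [(x + scale N1 _) v]ffunE [(x + scale N2 _)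
      v]ffunE !ffunE => {}e.
    rewrite !mulrA divfK ?gt_eqF //; lra.
  have bs : b \in s.
    rewrite -y2s inE; have := congr1 (fun f : {ffun U -> R} => f b) v_eq.
    rewrite /= !ffunE eqxx mulr1 => e; have y1b := y10 b.
    have : 0 < (N2 - N1) / c by rewrite divr_gt0 //; lra.
    by rewrite -e => h; rewrite gt_eqF //; lra.
  exists (forget b y1).
    split; first by move=> u; rewrite ffunE; case: ifP.
    by rewrite support_forget y1s link1E // setD1K // -{2}y1s y1M !inE eqxx.
  rewrite lin_forget; have e : y1 = forget b y1 + scale (y1 b) (point R b).
    apply/ffunP=> u; rewrite !ffunE; case: eqP => [->|_];
      first by rewrite add0r mulr1.
    by rewrite mulr0 addr0.
  have := y1x; rewrite {1}e linD linZ lin_point pb => {}e.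
  apply/ffunP=> v; have := congr1 (fun f : {ffun T -> R} => f v) e.
  rewrite /= [(lin p _ + _) v]ffunE [(x + _) v]ffunE [forget a _ v]ffunE.
  have [->|va] := eqVneq v a; first by move: ax; rewrite inE negbK => /eqP->.
  by rewrite !ffunE (negPf va) !mulr0 !addr0.
Qed.

End Links.

(** * Suspensions and normalization *)

Section Subdivisions.
Local Open Scope ring_scope.
Variable R : realType.

Local Notation lin := (@linear_extension R _ _).

(** The ray of [a] is extreme among nonnegative vectors: when a nonnegative combination of the [p u]
    lies on it, so does every [p u] with positive coefficient. *)
Lemma vertex_preimage (U T : finType) (p : U -> {ffun T -> R}) M K a :
  refines p M K -> [set a] \in K ->
  exists b c, [/\ [set b] \in M, 0 < c & p b = scale c (point R a)].
Proof.
move=> rp aK; have [Mc pf pi ps] := rp.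
have [y [y0 yM] ya] := ps _ (cone_point R aK).
have [b yb] : exists b, b \in support y.
  apply/set0Pn/eqP => /support_eq0 yE; move: ya; rewrite yE lin0.
  by move/ffunP/(_ a)/eqP; rewrite zero_ffunE ffunE eqxx eq_sym oner_eq0.
have bM : [set b] \in M by apply: face_point yM yb.
have [t _ pt] := pf _ yM.
have yb0 : 0 < y b by rewrite lt_neqAle y0 eq_sym; move: yb; rewrite inE => ->.
have pv v : v != a -> p b v = 0.
  move=> va; have := congr1 (fun f : {ffun T -> R} => f v) ya.
  rewrite /= !ffunE (negPf va) (bigD1 b) //= => /eqP.
  have pbv : 0 <= p b v by have [] := pt b yb.
  rewrite paddr_eq0 ?mulr_ge0 //;
    first by rewrite mulf_eq0 gt_eqF //= => /andP[/eqP].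
  apply: sumr_ge0 => u _; have [->|yu] := eqVneq (y u) 0; first by rewrite mul0r.
  by rewrite mulr_ge0 //; have [] := pt u; rewrite ?inE.
have pb : p b = scale (p b a) (point R a).
  apply/ffunP=> v; rewrite !ffunE; have [->|va] := eqVneq v a;
    first by rewrite mulr1.
  by rewrite mulr0 pv.
exists b, (p b a); split=> //; rewrite lt_neqAle; have [-> _] := pt b yb.
rewrite andbT eq_sym; apply/eqP=> pba; have /eqP[] := refines_neq0 rp bM.
by rewrite pb pba; apply/ffunP=> v; rewrite zero_ffunE ffunE mul0r.
Qed.

(** * Suspension of a refinement *)

Definition suspension_map (U T : finType) (p : U -> {ffun T -> R})
    (o : (bool + U)%type) : {ffun (bool + T)%type -> R} :=
  match o with
  | inl e => point R (inl e)
  | inr u => [ffun o => if o is inr v then p u v else 0]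
  end.

Lemma lin_suspension_mapl (U T : finType) (p : U -> {ffun T -> R}) y e :
  lin (suspension_map p) y (inl e) = y (inl e).
Proof.
rewrite ffunE big_sumType /= [X in _ + X]big1 ?addr0 => [|u _].
  by rewrite big_bool /= !ffunE; case: e;
    rewrite /= ?eqxx ?mulr1 ?mulr0 ?addr0 ?add0r.
by rewrite ffunE mulr0.
Qed.

Lemma lin_suspension_mapr (U T : finType) (p : U -> {ffun T -> R}) y v :
  lin (suspension_map p) y (inr v) = lin p [ffun u => y (inr u)] v.
Proof.
rewrite ffunE big_sumType /= big1 ?add0r => [|e _].
  by rewrite ffunE; apply: eq_bigr => u _; rewrite !ffunE.
by rewrite ffunE mulr0.
Qed.

Lemma cone_suspension (T : finType) (K : {set {set T}}) (x : {ffun (bool +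
  T)%type -> R}) :
  cone (suspension K) x <->
  [/\ cone K [ffun v => x (inr v)], forall e, 0 <= x (inl e) &
      ~~ ((x (inl true) != 0) && (x (inl false) != 0))].
Proof.
have e : rights (support x) = support [ffun v => x (inr v)].
  by apply/setP=> v; rewrite !inE ffunE.
split=> [[x0]|[[x0 xK] xl tf]].
  rewrite suspensionE !inE e => /andP[tf xK]; split=> //; split=> // v.
  by rewrite ffunE.
split; first by case=> // v; have := x0 v; rewrite ffunE.
by rewrite suspensionE !inE e xK tf.
Qed.

Lemma suspension_refines (U T : finType) (p : U -> {ffun T -> R}) M K :
  refines p M K -> refines (suspension_map p) (suspension M) (suspension K).
Proof.
move=> [Mc pf pi ps]; split; first exact: suspension_complex.
- move=> S; rewrite suspensionE => /andP[tf /pf[t tK pt]].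
  exists [set o | match o with inl e => inl e \in S | inr v => v \in t end].
    by rewrite suspensionE !inE tf; congr (_ \in K): tK; apply/setP=> v;
      rewrite !inE.
  case=> [e|u] uS.
    split; first exact: point_ge0.
    by rewrite support_point sub1set inE.
  have [|p0 put] := pt u; first by rewrite inE.
  split.
    by case=> [e|v]; rewrite ffunE.
  apply/subsetP=> -[e|v]; rewrite !inE ffunE ?eqxx // => puv.
  by apply: (subsetP put); rewrite inE.
- move=> y z /cone_suspension[yM _ _] /cone_suspension[zM _ _] yz.
  have yzr : [ffun u => y (inr u)] = [ffun u => z (inr u)].
    apply: pi => //; apply/ffunP=> v.
    by rewrite -!lin_suspension_mapr yz.
  apply/ffunP=> -[e|u].
    by rewrite -(lin_suspension_mapl p) yz lin_suspension_mapl.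
  by have := congr1 (fun f : {ffun U -> R} => f u) yzr; rewrite /= !ffunE.
- move=> x /cone_suspension[xK x0 tf]; have [y yM yx] := ps _ xK.
  exists [ffun o => match o with inl e => x (inl e) | inr u => y u end].
    apply/cone_suspension; rewrite !ffunE; split=> // [|e]; last by rewrite ffunE.
    by congr (cone M _): yM; apply/ffunP=> u; rewrite !ffunE.
  apply/ffunP=> -[e|v]; first by rewrite lin_suspension_mapl ffunE.
  rewrite lin_suspension_mapr.
  have -> : [ffun u => [ffun o => match o with inl e => x (inl e) | inr u =>
    y u end] (inr u)] = y.
    by apply/ffunP=> u; rewrite !ffunE.
  by rewrite yx ffunE.
Qed.

(** * Passage between realizations and cones *)

Definition mass (T : finType) (x : {ffun T -> R}) : R := \sum_v x v.

Lemma mass_lin (U T : finType) (p : U -> {ffun T -> R}) y :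
  mass (lin p y) = \sum_u y u * mass (p u).
Proof.
rewrite /mass; under eq_bigr do rewrite ffunE.
by rewrite exchange_big; apply: eq_bigr => u _; rewrite mulr_sumr.
Qed.

Lemma mass0 (T : finType) : mass (0 : {ffun T -> R}) = 0.
Proof. by rewrite /mass big1 // => v _; apply: zero_ffunE. Qed.

Lemma massZ (T : finType) a (x : {ffun T -> R}) : mass (scale a x) = a * mass x.
Proof. by rewrite /mass mulr_sumr; apply: eq_bigr => v _; rewrite ffunE. Qed.

Lemma mass_point (T : finType) (v : T) : mass (point R v) = 1.
Proof.
rewrite /mass (bigD1 v) //= ffunE eqxx big1 ?addr0 // => u uv.
by rewrite ffunE (negPf uv).
Qed.

Lemma mass_gt0 (T : finType) (x : {ffun T -> R}) :
  (forall v, 0 <= x v) -> x != 0 -> 0 < mass x.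
Proof.
move=> x0; rewrite lt_neqAle sumr_ge0 ?andbT //; apply: contra => /eqP/esym mx.
apply/eqP/ffunP=> v; rewrite zero_ffunE; apply/eqP; move: mx => /eqP.
by rewrite /mass psumr_eq0 // => /allP/(_ v); rewrite mem_index_enum; apply.
Qed.

Lemma scaleK (T : finType) a (x : {ffun T -> R}) : a != 0 ->
  scale a (scale a^-1 x) = x.
Proof. by move=> a0; apply/ffunP=> v; rewrite !ffunE mulrA divff // mul1r. Qed.

Lemma realizationE (T : finType) (K : {set {set T}}) (x : {ffun T -> R}) :
  realization K x <-> cone K x /\ mass x = 1.
Proof. by split=> [[x0 x1 xK]|[[x0 xK] x1]]. Qed.

(** The placements of vertices have mass 1, so [lin p] preserves mass and everything reduces to
    vectors of mass 1 by scaling; the zero vector is treated apart. *)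
Lemma subdivision_refines (U T : finType) (K' : {set {set U}}) (K : {set {set
  T}}) :
  simplicial_complex K -> subdivision R K' K ->
  exists p : U -> {ffun T -> R}, refines p K' K.
Proof.
move=> Kc [K'c [p [pf pr pi ps]]]; exists p.
have pu u : [set u] \in K' -> cone K (p u) /\ mass (p u) = 1.
  move=> uK'; apply/realizationE; rewrite -(lin_point p u); apply: pr.
  by apply/realizationE; rewrite mass_point; split=> //; apply: cone_point.
have massE y : cone K' y -> mass (lin p y) = mass y.
  move=> [y0 yK]; rewrite mass_lin; apply: eq_bigr => u _.
  have [->|yu] := eqVneq (y u) 0; first by rewrite mul0r.
  have uK' : [set u] \in K' by apply: face_point yK _; rewrite // inE.
  by have [_ ->] := pu u uK'; rewrite mulr1.
have normal (V : finType) (L : {set {set V}}) x : simplicial_complex L ->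
  cone L x -> x != 0 ->
    realization L (scale (mass x)^-1 x).
  move=> Lc xL x0; have m0 := mass_gt0 xL.1 x0; apply/realizationE.
  rewrite massZ mulVf ?gt_eqF //; split=> //; apply: coneZ => //.
  by rewrite invr_ge0 ltW.
split=> //.
- move=> s sK; have [t tK pt] := pf s sK; exists t => // u us; split;
  last exact: pt.
  by have [[]] := pu u (face_point K'c sK us).
- move=> y z yK zK yz; have e : mass y = mass z by rewrite -!massE // yz.
  have [y0|y0] := eqVneq y 0.
    move: e; rewrite y0 mass0 => e; have [-> //|z0] := eqVneq z 0.
    by have := mass_gt0 zK.1 z0; rewrite -e ltxx.
  have m0 := mass_gt0 yK.1 y0.
  have z0 : z != 0.
    by apply: contraTneq m0 => z0; rewrite e z0 mass0 ltxx.
  rewrite -(@scaleK _ (mass y) y) ?gt_eqF // -(@scaleK _ (mass y) z) ?gt_eqF //.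
  congr scale; apply: pi; first exact: normal.
    by rewrite e; apply: normal.
  by rewrite !linZ yz.
- move=> x xK; have [->|x0] := eqVneq x 0.
    by exists 0; [apply: cone0|rewrite lin0].
  have m0 := mass_gt0 xK.1 x0.
  have [y /realizationE[yK y1] yx] := ps _ (normal _ _ _ Kc xK x0).
  exists (scale (mass x) y); first by apply: coneZ => //; apply: ltW.
  by rewrite linZ yx scaleK // gt_eqF.
Qed.

(** Dividing each placement by its mass leaves its ray unchanged, and the rescaling [d] of the
    coordinates compensates for it. The mass is positive since no vertex is placed at [0]. *)
Lemma refines_subdivision (U T : finType) (p : U -> {ffun T -> R}) K' K :
  simplicial_complex K -> refines p K' K -> subdivision R K' K.
Proof.
move=> Kc rp; have [K'c pf pi ps] := rp; split=> //.
pose d (y : {ffun U -> R}) : {ffun U -> R} := [ffun u => y u / mass (p u)].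
pose n u := scale (mass (p u))^-1 (p u).
have linn y : lin n y = lin p (d y).
  by apply/ffunP=> v; rewrite !ffunE; apply: eq_bigr => u _; rewrite !ffunE mulrA.
have m0 s u : s \in K' -> u \in s -> 0 < mass (p u).
  move=> sK us; have uK := face_point K'c sK us; apply: mass_gt0.
    by have [t _ /(_ u us)[]] := pf s sK.
  exact: refines_neq0 rp uK.
have my (y : {ffun U -> R}) u : cone K' y -> y u != 0 -> 0 < mass (p u).
  by move=> [_ yK] yu; apply: m0 yK _; rewrite inE.
have dcone y : cone K' y -> cone K' (d y).
  move=> yK; apply: cone_sub yK.2 _ _ => // [u|].
    have [yu|yu] := eqVneq (y u) 0; first by rewrite ffunE yu mul0r.
    by rewrite ffunE divr_ge0 ?yK.1 // ltW // (my y).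
  by apply/subsetP=> u; rewrite !inE ffunE mulf_eq0 negb_or => /andP[].
exists n; split.
- move=> s sK; have [t tK pt] := pf s sK; exists t => // u us.
  by apply: subset_trans (supportZ _ _) _; have [] := pt u us.
- move=> y /realizationE[yK y1]; apply/realizationE; split.
    by rewrite linn; apply: refines_cone rp _ => //; apply: dcone.
  rewrite mass_lin -y1; apply: eq_bigr => u _.
  have [->|yu] := eqVneq (y u) 0; first by rewrite mul0r.
  by rewrite massZ mulVf ?mulr1 // gt_eqF // (my y).
- move=> y z /realizationE[yK _] /realizationE[zK _]; rewrite !linn => yz.
  have dyz := pi _ _ (dcone _ yK) (dcone _ zK) yz; apply/ffunP=> u.
  have := congr1 (fun f : {ffun U -> R} => f u) dyz; rewrite /= !ffunE.
  have [yu|yu] := eqVneq (y u) 0.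
    have [-> _|zu] := eqVneq (z u) 0; first by rewrite yu.
    rewrite yu mul0r => /esym/eqP; rewrite mulf_eq0 invr_eq0 (negPf zu) /=.
    by rewrite gt_eqF // (my z).
  by apply: mulIf; rewrite invr_eq0 gt_eqF // (my y).
- move=> x /realizationE[xK x1]; have [y yK yx] := ps _ xK.
  pose z : {ffun U -> R} := [ffun u => y u * mass (p u)].
  have zK : cone K' z.
    apply: cone_sub yK.2 _ _ => // [u|].
      have [yu|yu] := eqVneq (y u) 0; first by rewrite ffunE yu mul0r.
      by rewrite ffunE mulr_ge0 ?yK.1 // ltW // (my y).
    by apply/subsetP=> u; rewrite !inE ffunE mulf_eq0 negb_or => /andP[].
  have zx : d z = y.
    apply/ffunP=> u; rewrite !ffunE; have [->|yu] := eqVneq (y u) 0;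
      first by rewrite !mul0r.
    by rewrite mulfK // gt_eqF // (my y).
  exists z; last by rewrite linn zx.
  apply/realizationE; split=> //; rewrite -x1 -yx mass_lin.
  by apply: eq_bigr => u _; rewrite ffunE.
Qed.

(** The two subdivisions of the definition are merged into one complex [M]: an isomorphism is itself
    a refinement and can be composed with a placement. *)
Definition sphere_like (T : finType) (K : {set {set T}}) : Prop :=
  exists (U W : finType) (M : {set {set U}}) (s : {set W})
         (p : U -> {ffun T -> R}) (q : U -> {ffun W -> R}),
    [/\ s != set0, refines p M K & refines q M (boundary s)].

Lemma pl_sphereE (T : finType) (K : {set {set T}}) :
  pl_sphere R K <-> [/\ simplicial_complex K, pure K & sphere_like K].
Proof.
split=> -[Kc Kp].
  move=> [n [U [W [K' [B' [K'K B'n iso]]]]]]; split=> //.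
  have n0 : [set: 'I_n.+1] != set0 by apply/set0Pn; exists ord0; rewrite inE.
  have nc := boundary_complex n0.
  have [p rp] := subdivision_refines Kc K'K.
  have [q rq] := subdivision_refines nc B'n.
  have K'c : simplicial_complex K' by case: rp.
  have [e re] := isomorphic_refines R K'c iso.
  by exists U, 'I_n.+1, K', [set: 'I_n.+1], p, (fun u => lin q (e u)); split=> //;
    apply: refines_trans rq re.
move=> [U [W [M [s [p [q [s0 rp rq]]]]]]]; split=> //.
have sc := boundary_complex s0.
have [e re] := isomorphic_refines R sc (boundary_isomorphic s0).
have nc : simplicial_complex (boundary [set: 'I_#|s|.-1.+1]).
  by apply: boundary_complex; apply/set0Pn; exists ord0; rewrite inE.
exists #|s|.-1, U, U, M, M; split.
- exact: refines_subdivision rp.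
- exact: refines_subdivision (refines_trans nc re rq).
- by exists Some; split=> // x y _ _ [].
Qed.

Lemma sphere_like_refines (U T : finType) (p : U -> {ffun T -> R}) K' K :
  simplicial_complex K -> refines p K' K -> sphere_like K' -> sphere_like K.
Proof.
move=> Kc rp [V [W [M [s [q [r [s0 rq rr]]]]]]].
by exists V, W, M, s, (fun u => lin p (q u)), r; split=> //;
  apply: refines_trans rp rq.
Qed.

Lemma sphere_like_iso (U T : finType) (L : {set {set U}}) (K : {set {set T}}) :
  simplicial_complex K -> simplicial_complex L ->
  isomorphic L K -> sphere_like L -> sphere_like K.
Proof.
move=> Kc Lc /(isomorphic_refines R Lc)[p rp]; exact: sphere_like_refines rp.
Qed.

Lemma sphere_like_stell (T : finType) (s : {set T}) (K : {set {set T}}) :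
  simplicial_complex K -> s != set0 -> sphere_like K -> sphere_like (stell s K).
Proof.
move=> Kc s0 [U [W [M [t [p [q [t0 rp rq]]]]]]].
pose w : {ffun T -> R} := [ffun v => (v \in s)%:R].
have w0 v : 0 <= w v by rewrite ffunE ler0n.
have sw : support w = s by apply/setP=> v; rewrite inE ffunE pnatr_eq0 eqb0 negbK.
rewrite -sw in s0 *; have [V [M' [p' [r [rp' rr _]]]]] := common_refinement Kc rp
  w0 s0.
exists V, W, M', t, r, (fun u => lin q (p' u)); split=> //.
exact: refines_trans (boundary_complex t0) rq rp'.
Qed.

End Subdivisions.

(** * PL spheres *)

Lemma isomorphic_wedge_twins (T U : finType) (K : {set {set T}})
    (L : {set {set U}}) (v : U) :
  simplicial_complex K -> simplicial_complex L -> v \in vertices L ->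
  isomorphic K (wedge v L) ->
  exists x y, [/\ x != y, twins x y K & [set x; y] \in K].
Proof.
move=> Kc Lc vL iso.
have W0 : set0 \in wedge v L.
  rewrite wedgeE // in_set0; congr (_ \in L): (Lc.1).
  by apply/setP=> x; rewrite !inE andbF.
have [x [y [xy xyt xyK]]] := isomorphic_twins Kc iso W0 (isT : Some v != None)
  (@wedge_twins _ v _ Lc).
exists x, y; split=> //; apply: xyK; rewrite wedgeE // !inE eqxx orbT.
by rewrite somesU somes_set1 somes_set1N setU0; rewrite inE in vL.
Qed.

Lemma isomorphic_suspension_twins (T U : finType) (K : {set {set T}})
    (L : {set {set U}}) :
  simplicial_complex K -> simplicial_complex L -> isomorphic K (suspension L) ->
  exists x y, x != y /\ twins x y K.
Proof.
move=> Kc Lc iso; have [S0 _] := suspension_complex Lc.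
have np : inl true != inl false :> bool + U by [].
have [x [y [xy xyt _]]] := isomorphic_twins Kc iso S0 np (@suspension_twins_poles
  _ L).
by exists x, y.
Qed.

Section Spheres.
Variable R : realType.

Local Notation lin := (@linear_extension R _ _).

Lemma stell_refinesE (T : finType) (s : {set T}) (K : {set {set T}}) :
  simplicial_complex K -> s != set0 ->
  exists p : option T -> {ffun T -> R}, refines p (stell s K) K.
Proof.
move=> Kc s0; pose w : {ffun T -> R} := [ffun v => (v \in s)%:R%R].
have w0 v : (0 <= w v)%R by rewrite ffunE ler0n.
have sw : support w = s by apply/setP=> v; rewrite inE ffunE pnatr_eq0 eqb0 negbK.
by rewrite -sw in s0 *; exists (centered w); apply: stell_refines.
Qed.

(** The only minimal non-face of a simplex boundary is the whole vertex set, so any two vertices are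
    twins, and subdividing the edge from [c] to [None] gives the suspension of the link of [None], a
    copy of [boundary s]. If [s] has one element, this edge is not a face and [stell] is a mere
    copy. *)
Lemma boundary_suspension (T : finType) (s : {set T}) : s != set0 ->
  exists p : bool + T -> {ffun option T -> R},
    refines p (suspension (boundary s)) (boundary (None |: Some @: s)).
Proof.
move=> s0; have [c cs] := set0Pn _ s0;
  pose s' : {set option T} := None |: Some @: s.
have s'0 : s' != set0 by apply/set0Pn; exists None; rewrite !inE.
have sc := boundary_complex s0; have s'c := boundary_complex s'0.
have nc : Some c != None by [].
have tw : twins (Some c) None (boundary s').
  move=> F; rewrite !inE => Fs; split=> nF.
    rewrite properE subUset sub1set !inE mem_imset ?cs ?(proper_sub Fs) /=;
      last exact: Some_inj.
    by apply/subsetPn; exists None; rewrite !inE // (negPf nF).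
  rewrite properE subUset sub1set !inE (proper_sub Fs) /=.
  apply/subsetPn; exists (Some c); rewrite !inE ?(negPf nF) //.
  by rewrite mem_imset ?cs //; apply: Some_inj.
have Ns' : [set None] \in boundary s'.
  by have := (tw set0 s'c.1).2; rewrite setU0; apply; rewrite inE.
have Lc := link1_complex s'c Ns'.
have iso : isomorphic (boundary s) (link (boundary s') [set None]).
  apply: (@isomorphic_pcan _ _ Some id) => //; first by case.
    by move=> t [u|] //; rewrite link1E // => /andP[/negPf->].
  move=> t; rewrite link1E // mem_some_imset /= !inE !properE.
  have sub (A B : {set T}) : (None |: Some @: A \subset None |: Some @: B) = (A
    \subset B).
    apply/idP/idP=> [/somesS|AB]; last by rewrite setUS ?imsetS.
    by rewrite !somesU !somesK somes_set1N !set0U.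
  by rewrite !sub.
have [e re] := isomorphic_refines R sc iso.
have ab0 : [set Some c; None] != set0 by apply/set0Pn; exists None; rewrite !inE.
have [i ri] := isomorphic_refines R (suspension_complex Lc)
  (isomorphic_sym (stell_complex s'c ab0) (twins_stell_isomorphic s'c nc tw)).
have [j rj] := stell_refinesE s'c ab0.
have r1 := refines_trans s'c rj ri.
exists (fun o => lin (fun o => lin j (i o)) (suspension_map e o)).
exact: refines_trans s'c r1 (suspension_refines re).
Qed.

Lemma sphere_like_suspension (T : finType) (K : {set {set T}}) :
  simplicial_complex K -> sphere_like R K -> sphere_like R (suspension K).
Proof.
move=> Kc [U [W [M [s [p [q [s0 rp rq]]]]]]].
have [e re] := boundary_suspension s0.
have s'0 : None |: Some @: s != set0 by apply/set0Pn; exists None; rewrite !inE.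
exists (bool + U)%type, (option W), (suspension M), (None |: Some @: s),
  (suspension_map p), (fun o => lin e (suspension_map q o)); split=> //.
  exact: suspension_refines.
exact: refines_trans (boundary_complex s'0) re (suspension_refines rq).
Qed.

Lemma pl_sphere_isomorphic (T U : finType) (K : {set {set T}}) (L : {set {set
  U}}) :
  simplicial_complex L -> isomorphic K L -> pl_sphere R K -> pl_sphere R L.
Proof.
move=> Lc iso /pl_sphereE[Kc Kp Ks]; apply/pl_sphereE; split=> //.
  exact: pure_isomorphic Kp.
exact: sphere_like_iso iso Ks.
Qed.

Lemma pl_sphere_stell (T : finType) (s : {set T}) (K : {set {set T}}) :
  s != set0 -> pl_sphere R K -> pl_sphere R (stell s K).
Proof.
move=> s0 /pl_sphereE[Kc Kp Ks]; apply/pl_sphereE; split.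
- exact: stell_complex.
- exact: pure_stell.
- exact: sphere_like_stell.
Qed.

(** Edge or not, [stell] at the pair is the suspension of the link and refines [K]. This treats
    wedges and suspensions together, and yields doublings one vertex at a time. *)
Lemma pl_sphere_twins (T : finType) (K : {set {set T}}) (a b : T) :
  simplicial_complex K -> a != b -> twins a b K -> [set b] \in K ->
  pl_sphere R (link K [set b]) -> pl_sphere R K.
Proof.
move=> Kc nab ab bK /pl_sphereE[Lc Lp Ls]; apply/pl_sphereE; split=> //.
  exact: pure_twins ab bK Lp.
have ab0 : [set a; b] != set0 by apply/set0Pn; exists a; rewrite !inE eqxx.
have sc := stell_complex Kc ab0.
have [p rp] := stell_refinesE Kc ab0; apply: (sphere_like_refines Kc rp).
apply: sphere_like_iso (isomorphic_sym sc (twins_stell_isomorphic Kc nab ab)) _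
  => //.
  exact: suspension_complex.
exact: sphere_like_suspension.
Qed.

(* The link of the center of a stellar subdivision of the boundary of a
   simplex [s] at a face [t] is the join of the boundaries of [t] and of
   [s :\: t]; it is also a stellar subdivision at [t] of the boundary of
   the facet [s :\ c], the new vertex being [c]. *)
Lemma boundary_stell_link (T : finType) (s t : {set T}) (c : T) :
  t != set0 -> t \proper s -> c \in s -> c \notin t ->
  isomorphic (link (stell t (boundary s)) [set None]) (stell t (boundary (s :\
    c))).
Proof.
move=> t0 ts cs ct; have s0 : s != set0 by apply/set0Pn; exists c.
have sc := boundary_complex s0; have stc := stell_complex sc t0.
pose f (o : option T) : option T :=
  if o is Some v then if v == c then None else Some v else Some c.
pose g o := Some (f o).
have ff : involutive f.
  case=> [v|] /=; last by rewrite eqxx.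
  by case: eqVneq => [->|vc] //=; rewrite (negPf vc).
have fg : pcancel f g by move=> o; rewrite /g ff.
have gf : ocancel g f by move=> o; rewrite /g /= ff.
apply: (isomorphic_pcan fg gf) => // F; rewrite link1E // [LHS]inE.
rewrite !inE (mem_imset_pcan _ _ fg gf) eqxx orTb /=.
have tc : t \subset s :\ c.
  by apply/subsetP=> x xt; rewrite !inE (subsetP (proper_sub ts)) // andbT;
    apply: contraNneq ct => <-.
have sE v : (Some v \in f @: F) = if v == c then None \in F else Some v \in F.
  by rewrite (mem_imset_pcan _ _ fg gf) /=; case: ifP.
have [NF|NF] /= := boolP (None \in F).
  apply/negbTE; rewrite negb_and orbC; apply/orP; left.
  by apply/negP=> /proper_sub/subsetP/(_ c); rewrite !inE sE eqxx NF => /(_ isT).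
have e1 : somes (f @: F) = somes F :\ c.
  by apply/setP=> v; rewrite !inE sE; case: eqP => // _; apply/negbTE.
have e2 : somes (None |: F) = somes F by apply/setP=> v; rewrite !inE.
have tF : (t \subset somes F :\ c) = (t \subset somes F).
  by rewrite subsetD1 ct andbT.
rewrite e1 e2 tF; case: (boolP (t \subset somes F)) => //= tnF.
have [cF|cF] := boolP (Some c \in F).
  have subD (X Y : {set T}) : c \in X -> c \in Y ->
    (X :\ c \subset Y :\ c) = (X \subset Y).
    move=> cX cY; apply/idP/idP=> [/(setUS [set c])|/setSD-> //].
    by rewrite !setD1K.
  have -> : somes F :\ c :|: t = (somes F :|: t) :\ c.
    by apply/setP=> x; rewrite !inE; case: eqVneq => //= ->; apply/negbTE.
  by rewrite !properE !subD // !inE cF.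
have -> : somes F :\ c = somes F.
  by apply/setP=> x; rewrite !inE; case: eqVneq => //= ->; rewrite (negPf cF).
rewrite setU0; apply/idP/idP=> [/proper_sub As|/proper_sub].
  apply/properP; split; last by exists c; rewrite // !inE negb_or cF ct.
  by rewrite subUset (proper_sub ts) andbT (subset_trans As) ?subD1set.
rewrite subUset properE subsetD1 inE cF => /andP[-> _] /=.
by apply: contra tnF; apply: subset_trans.
Qed.

Lemma pl_sphere_link (T : finType) (K : {set {set T}}) (a : T) :
  [set a] \in K -> pl_sphere R K -> pl_sphere R (link K [set a]).
Proof.
move=> aK /pl_sphereE[Kc Kp [U [W [M [s [p [r [s0 rp rr]]]]]]]].
apply/pl_sphereE; split; [exact: link1_complex|exact: pure_link|].
have [b [c [bM c0 pb]]] := vertex_preimage rp aK.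
have sc := boundary_complex s0; have [Mc _ _ _] := rp.
have [_ rf ri _] := rr; have [t' t's /(_ b (set11 b))[x0 xt']] := rf _ bM.
pose t := support (r b); have ts : t \proper s.
  by apply: sub_proper_trans xt' _; rewrite inE in t's.
have t0 : t != set0.
  by apply: contraNneq (refines_neq0 rr bM) => /support_eq0->.
have [V [M' [q [r' [rq rr' qr]]]]] := common_refinement sc rr x0 t0.
have stc := stell_complex sc t0.
have NS : [set None] \in stell t (boundary s).
  by rewrite inE somes_set1N subset0 t0 set0U !inE eqxx.
have [b' [c' [b'M c'0 r'b']]] := vertex_preimage rr' NS.
have [M'c _ _ _] := rq.
(* [b'] lies over the center, which is the image [r b], and [lin r] is injective; so [b'] lies over
   [b] and thereby over [a]. The link of [b'] then refines the link of [a] as well as the link of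
   the center. *)
have qb' : q b' = scale c' (point R b).
  apply: ri.
  - by rewrite -(lin_point q); apply: refines_cone rq _ => //; apply: cone_point.
  - by apply: coneZ (ltW c'0) (cone_point R bM).
  - by rewrite qr // r'b' !linZ !lin_point.
have pqb' : lin p (q b') = scale (c' * c)%R (point R a).
  by rewrite qb' linZ lin_point pb; apply/ffunP=> v; rewrite !ffunE mulrA.
have rL := link_refines Kc (refines_trans Kc rp rq) aK b'M (mulr_gt0 c'0 c0) pqb'.
have rS := link_refines stc rr' NS b'M c'0 r'b'.
have [d ds dt] : exists2 d, d \in s & d \notin t by case/properP: ts.
have iso := boundary_stell_link t0 ts ds dt.
have sd0 : s :\ d != set0.
  have [e et] := set0Pn _ t0; apply/set0Pn; exists e.
  by rewrite !inE (subsetP (proper_sub ts)) // andbT; apply: contraNneq dt => <-.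
have sdc := boundary_complex sd0.
have [i rI] := isomorphic_refines R (link1_complex stc NS) iso.
have [j rj] := stell_refinesE sdc t0.
eexists V, W, _, (s :\ d), _, _; split; [exact: sd0|exact: rL|].
exact: refines_trans sdc (refines_trans sdc rj rI) rS.
Qed.

Lemma pl_sphere_doubling (T : finType) (D : {set T}) (K : {set {set T}}) :
  pl_sphere R K -> pl_sphere R (doubling D K).
Proof.
move=> Ks; have Kc : simplicial_complex K by case/pl_sphereE: Ks.
have [n] := ubnP #|D|; elim: n => // n IHn in D *; rewrite ltnS => Dn.
have [->|[v vD]] := set_0Vmem D.
  exact: pl_sphere_isomorphic (doubling_complex _ Kc) (doubling0_isomorphic K) Ks.
apply: (pl_sphere_twins _ _ (doubling_twins Kc vD)) => //.
- exact: doubling_complex.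
- by rewrite xpair_eqE andbF.
- exact: doubling_vertex.
- by rewrite doubling_link //; apply: IHn; rewrite (cardsD1 v) vD in Dn.
Qed.

Lemma seed_twins (T : finType) (K : {set {set T}}) (a b : T) :
  seed R K -> a != b -> twins a b K -> [set a; b] \notin K.
Proof.
move=> [Ks nW] nab ab; apply/negP=> abK; apply: nW.
have Kc : simplicial_complex K by case/pl_sphereE: Ks.
have bK : [set b] \in K by apply: Kc.2 abK (subsetUr _ _).
exists T, (link K [set b]), a; split.
- exact: pl_sphere_link.
- by rewrite inE link1E // inE eq_sym nab setUC.
- exact: twins_wedge_isomorphic.
Qed.

Lemma seed_nonsuspended_twins (T : finType) (K : {set {set T}}) (a b : T) :
  seed R K -> ~ suspended R K -> a != b -> ~ twins a b K.
Proof.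
move=> Kseed nS nab ab; have abK := seed_twins Kseed nab ab.
have Ks := Kseed.1; have Kc : simplicial_complex K by case/pl_sphereE: Ks.
have bK : [set b] \in K.
  by have := (ab _ Kc.1).2; rewrite setU0 inE; apply.
apply: nS; exists T, (link K [set b]); split; first exact: pl_sphere_link.
exact: (twins_suspension_isomorphic Kc nab ab abK).
Qed.

End Spheres.

Theorem theorem3p1 (R : realType) (m : nat) (K : {set {set 'I_m}})
    (J : 'I_m -> nat)
    (K_seed : seed R K) (K_vertices : vertices K = [set: 'I_m])
    (J_pos : forall v : 'I_m, 0 < J v) (J_le2 : forall v : 'I_m, J v <= 2)
    (sigma : {set copies J})
    (sigma_assembled :
       exists s : forall v : 'I_m, 'I_(J v), sigma = assembled_face s) :
  (forall (v : 'I_m) (v_doubled : 1 < J v),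
     let v0 := copy (Ordinal (J_pos v)) in
     let v1 := copy (Ordinal v_doubled) in
     sigma = [set v0] ->
     seed R (stellar_subdivision [set v0; v1] (J_construction K J)) /\
     suspended R (stellar_subdivision [set v0; v1] (J_construction K J)))
  /\
  (1 < #|sigma| -> ~ suspended R K ->
     seed R (stellar_subdivision sigma (J_construction K J)) /\
     ~ suspended R (stellar_subdivision sigma (J_construction K J))).
Proof.
have Ks := K_seed.1; have Kc : simplicial_complex K by case/pl_sphereE: Ks.
pose D := [set v | 1 < J v].
have KJc := J_construction_complex Kc J_pos.
have [s sE] := sigma_assembled.
have KJs : pl_sphere R (J_construction K J).
  have Ds := pl_sphere_doubling D Ks; apply: (pl_sphere_isomorphic KJc _ Ds).
  exact: isomorphic_sym KJc (J_construction_isomorphic s J_le2 Kc).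
split=> [v Jv v0 v1 sv|sigma2 nS].
  (* [sigma] contains a copy of each doubled vertex. *)
  have DE : D = [set v].
    apply/setP=> u; rewrite !inE; apply/idP/eqP=> [Ju|->//].
    have : copy (s u) \in sigma by rewrite sE; apply/imsetP; exists u;
      rewrite ?inE.
    by rewrite sv inE => /eqP/(congr1 tag).
  (* Selecting the index 0 everywhere turns [v0] and [v1] into [(v, false)] and [(v, true)]. *)
  pose s0 u : 'I_(J u) := Ordinal (J_pos u).
  have pairs : to_pair s0 @: [set v0; v1] = [set (v, false); (v, true)].
    by rewrite imsetU1 imset_set1 /to_pair /=.
  have vD : v \in D by rewrite inE.
  have nv : (v, false) != (v, true) by rewrite xpair_eqE andbF.
  have tw := doubling_twins Kc vD.
  (* The core of this pair is [[set v]], a face because there are no ghost vertices. *)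
  have vvD : [set (v, false); (v, true)] \in doubling D K.
    apply/doublingP; split=> [u|];
      first by rewrite !inE !xpair_eqE andbF andbT => /eqP->.
    have : v \in vertices K by rewrite K_vertices inE.
    rewrite inE; congr (_ \in K); apply/setP=> u;
      rewrite !inE !xpair_eqE !andbF !andbT /= orbF.
    by case: eqP; rewrite ?implybT.
  have KJv : [set v0; v1] \in J_construction K J.
    by rewrite -(J_construction_doubling s0 J_le2 _ Kc) pairs.
  have vv0 : [set v0; v1] != set0 by apply/set0Pn; exists v0; rewrite !inE eqxx.
  rewrite stellE //; set M := stell _ _.
  have Mc : simplicial_complex M by apply: stell_complex.
  (* A copy of [K] on pairs: with [v] removed from [D] nothing is doubled. *)
  pose L := doubling set0 K;
    have Lc : simplicial_complex L := doubling_complex _ Kc.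
  have LE : link (doubling D K) [set (v, true)] = L.
    by rewrite doubling_link // DE setDv.
  have iso : isomorphic M (suspension L).
    have := J_construction_stell_isomorphic s0 J_le2 [set v0; v1] Kc.
    rewrite pairs => iso; apply: (isomorphic_trans _ iso).
      apply: stell_complex; first exact: doubling_complex.
      by apply/set0Pn; exists (v, true); rewrite !inE eqxx orbT.
    by rewrite -LE; apply: twins_stell_isomorphic => //; apply: doubling_complex.
  split; last by exists ('I_m * bool)%type, L; split=> //;
    apply: pl_sphere_doubling.
  split; first exact: pl_sphere_stell.
  move=> [U [N [u [Ns uN isoW]]]];
    have Nc : simplicial_complex N by case/pl_sphereE: Ns.
  have Sc := suspension_complex Lc.
  (* The twins of a wedge span an edge. In the suspension such twins come from [L], hence from the
     seed [K], where twins span no edge. *)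
  have [|x [y [xy xyt xyS]]] := isomorphic_wedge_twins Sc Nc uN.
    exact: isomorphic_trans Mc (isomorphic_sym Mc iso) isoW.
  have [x' [y' [xy' xyt' xyL]]] := suspension_twins Lc xy xyt xyS.
  have [a [b [ab abt abK]]] :=
    isomorphic_twins Kc (doubling0_isomorphic K) Lc.1 xy' xyt'.
  by have := seed_twins K_seed ab abt; rewrite abK.
have D2 : 1 < #|D|.
  by apply: leq_trans sigma2 _;
    rewrite sE (leq_trans (leq_imset_card _ _)) // cardsE.
have pairs : to_pair s @: sigma = zero_copies D
  by rewrite sE assembled_face_pairs.
have sigmaK : sigma \in J_construction K J.
  rewrite -(J_construction_doubling s J_le2 _ Kc) pairs; apply/doublingP; split.
    by move=> v; rewrite !inE andbF.
  congr (_ \in K): (Kc.1); apply/setP=> v; rewrite !inE /= !andbF andbT.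
  by case: (1 < J v); rewrite ?andbF.
have sigma0 : sigma != set0 by rewrite -card_gt0 (ltn_trans _ sigma2).
rewrite stellE //; set M := stell _ _.
have Mc : simplicial_complex M by apply: stell_complex.
have iso := J_construction_stell_isomorphic s J_le2 sigma Kc.
have z0 : zero_copies D != set0.
  by rewrite -pairs; apply: contra sigma0; rewrite imset_eq0.
rewrite pairs -/D in iso; set M' := stell (zero_copies D) _ in iso.
have M'c : simplicial_complex M' by apply: stell_complex => //;
  apply: doubling_complex.
(* Wedges and suspensions both have twins, so this claim excludes both. *)
have nt x y : x != y -> ~ twins x y M'.
  move=> xy xyt; have [a [b [ab abt]]] := stell_doubling_twins Kc D2 M'c.1 xy xyt.
  exact: seed_nonsuspended_twins K_seed nS ab abt.
split; last first.
  move=> [U [N [Ns isoN]]]; have Nc : simplicial_complex N by case/pl_sphereE: Ns.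
  have [|x [y [xy xyt]]] := isomorphic_suspension_twins M'c Nc.
    exact: isomorphic_trans Mc (isomorphic_sym Mc iso) isoN.
  exact: nt xyt.
split; first exact: pl_sphere_stell.
move=> [U [N [u [Ns uN isoW]]]];
  have Nc : simplicial_complex N by case/pl_sphereE: Ns.
have [|x [y [xy xyt _]]] := isomorphic_wedge_twins M'c Nc uN.
  exact: isomorphic_trans Mc (isomorphic_sym Mc iso) isoW.
exact: nt xyt.
Qed.
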